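(* Let $\mathscr{C}\subset[0,1]$ be the Cantor set generated by an iterated function system $\{\phi_i:[0,1]\to[0,1] : i\in\mathcal I\}$ all of whose maps $\phi_i$ are real analytic functions on $[0,1]$. Then $$\Delta(\mathscr{C},\varepsilon)\preccurlyeq\big(\log(\varepsilon^{-1})\big)^2,$$ i.e. there is a constant $C>0$ (possibly depending on the system) such that $\Delta(\mathscr{C},\varepsilon)\le C(\log(\varepsilon^{-1}))^2$ for all sufficiently small $\varepsilon>0$.
   Context: Complexity. Fix a universal Turing machine $U$. A program is a finite binary word $\mathtt P\in\{0,1\}^*$ run on $U$, with length $\ell(\mathtt P)$; when it halts, its output is read (in a fixed standard encoding, e.g. as a finite list of points with rational coordinates) as a finite set $\mathtt C(\mathtt P)\subset\mathbb R$. For a compact set $\mathscr{C}\subset\mathbb R$ and $\varepsilon>0$, the $\varepsilon$-distortion complexity is $$\Delta(\mathscr{C},\varepsilon)=\min\{\ell(\mathtt P) : d_{\mathrm H}(\mathtt C(\mathtt P),\mathscr{C})<\varepsilon\},$$ where the minimum is over programs producing a finite set and $d_{\mathrm H}$ is the Hausdorff distance, $d_{\mathrm H}(F_1,F_2)=\max\{\sup_{x\in F_2}d(x,F_1),\sup_{x\in F_1}d(x,F_2)\}$. Iterated function systems. Let $A=[0,1]$ and let $\mathcal I$ be a finite index set with at least two elements. An iterated function system (IFS) is a collection $\{\phi_i:A\to A : i\in\mathcal I\}$ of injective contractions with a uniform contraction rate $\rho\in(0,1)$ (i.e. $|\phi_i(x)-\phi_i(y)|\le\rho|x-y|$ for all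 $i$) such that $\phi_i(A)\cap\phi_j(A)=\emptyset$ for $i\ne j$. The Cantor set generated by the IFS is the unique nonempty compact set $\mathscr{C}\subset A$ with $\mathscr{C}=\bigcup_{i\in\mathcal I}\phi_i(\mathscr{C})$; equivalently the set of points $\bigcap_{n}\phi_{\omega_1}\circ\cdots\circ\phi_{\omega_n}(A)$, $\omega\in\mathcal I^{\infty}$. A function is real analytic on $[0,1]$ if it extends to a real analytic function on an open neighbourhood of $[0,1]$. *)

(* Defs.v *)
From HB Require Import structures.
From mathcomp Require Import all_boot all_order all_algebra.
From mathcomp Require Import all_classical all_reals all_analysis.

Set Implicit Arguments.
Unset Strict Implicit.
Unset Printing Implicit Defensive.

Import Order.TTheory GRing.Theory Num.Theory.
Import numFieldNormedType.Exports.

Local Open Scope classical_set_scope.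
Local Open Scope ring_scope.

(* Deterministic Turing machines with finitely many two-way infinite tapes.   *)
(* The tape alphabet is {0, 1}, a blank ([None]), and a finite set of         *)
(* auxiliary symbols; a machine with [tm_tapes = 0] has a single tape.        *)
Inductive direction := Left | Stay | Right.

Record turing_machine := TuringMachine {
  tm_state : finType;
  tm_aux : finType;
  tm_tapes : nat;
  tm_start : tm_state;
  tm_halting : pred tm_state;
  tm_trans : tm_state ->
    {ffun 'I_tm_tapes.+1 -> option (bool + tm_aux)} ->
    tm_state * {ffun 'I_tm_tapes.+1 -> option (bool + tm_aux) * direction} }.

Section Run.
Variable M : turing_machine.

Definition symbol : Type := option (bool + tm_aux M).

(* [t.1] lists the cells to the left of the head, nearest first; [t.2] lists  *)
(* the scanned cell and those to its right.  Unlisted cells are blank.        *)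
Definition tape : Type := (seq symbol * seq symbol)%type.

Definition read (t : tape) : symbol := head None t.2.

Definition write (a : symbol) (t : tape) : tape := (t.1, a :: behead t.2).

Definition move (d : direction) (t : tape) : tape :=
  match d with
  | Left => (behead t.1, head None t.1 :: t.2)
  | Stay => t
  | Right => (head None t.2 :: t.1, behead t.2)
  end.

Definition config : Type := (tm_state M * {ffun 'I_(tm_tapes M).+1 -> tape})%type.

Definition step (c : config) : config :=
  if tm_halting c.1 then c else
  let: (q, act) := tm_trans c.1 [ffun i => read (c.2 i)] in
  (q, [ffun i => move (act i).2 (write (act i).1 (c.2 i))]).

(* The input is on the first tape, with the head on its first symbol. *)
Definition init (p : seq bool) : config :=
  (tm_start M,
   [ffun i => if i == ord0 then ([::], [seq Some (inl b) | b <- p])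
              else ([::], [::])]).

Fixpoint bit_prefix (s : seq symbol) : seq bool :=
  if s is Some (inl b) :: s' then b :: bit_prefix s' else [::].

(* The output is the block of bits on the last tape that starts at its head. *)
Definition output (c : config) : seq bool := bit_prefix (c.2 ord_max).2.

Definition computes (p w : seq bool) : Prop :=
  exists n, let c := iter n step (init p) in
    tm_halting c.1 /\ output c = w.

End Run.

(* [U] simulates every machine [M] on every input [p], when it is run on a    *)
(* description of [M] followed by [p].                                        *)
Definition universal (U : turing_machine) : Prop :=
  forall M : turing_machine, exists desc : seq bool,
    forall p w : seq bool, computes U (desc ++ p) w <-> computes M p w.

(* A fraction is a sign bit, the binary digits of the numerator and those of  *)
(* the denominator, most significant digit first.                             *)
Definition fraction : Type := (bool * seq bool * seq bool)%type.

Definition binary (ds : seq bool) : nat :=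
  foldl (fun n (b : bool) => (n.*2 + b)%N) 0%N ds.

Definition wf_fraction (x : fraction) : bool := (0 < binary x.2)%N.

Definition fraction_val (R : realType) (x : fraction) : R :=
  (-1) ^+ x.1.1 * (binary x.1.2)%:R / (binary x.2)%:R.

(* Every digit is preceded by 1, and 0 marks the end of the numeral. *)
Definition delimit (ds : seq bool) : seq bool :=
  flatten [seq [:: true; b] | b <- ds] ++ [:: false].

Definition encode_fraction (x : fraction) : seq bool :=
  x.1.1 :: delimit x.1.2 ++ delimit x.2.

Definition encode (s : seq fraction) : seq bool :=
  flatten [seq encode_fraction x | x <- s].

Definition produces (R : realType) (U : turing_machine) (p : seq bool)
    (F : set R) : Prop :=
  exists s : seq fraction,
    [/\ all wf_fraction s, computes U p (encode s)
      & F = [set` [seq fraction_val R x | x <- s]]].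

(* The extended reals make the distance between the empty set and a nonempty  *)
(* set infinite.                                                              *)
Definition dist_to (R : realType) (x : R) (F : set R) : \bar R :=
  ereal_inf [set (`|x - y|)%:E | y in F].

Definition hausdorff_dist (R : realType) (F1 F2 : set R) : \bar R :=
  Order.max (ereal_sup [set dist_to x F1 | x in F2])
            (ereal_sup [set dist_to x F2 | x in F1]).

(* The infimum of a set of natural numbers, hence its minimum if it is        *)
(* nonempty, and +oo if there is no suitable program.                         *)
Definition distortion_complexity (R : realType) (U : turing_machine)
    (K : set R) (eps : R) : \bar R :=
  ereal_inf [set ((size p)%:R)%:E | p in
    [set p : seq bool | exists2 F : set R,
       produces U p F & (hausdorff_dist F K < eps%:E)%E]].

(* The maps are given on the whole of [R]; only their values on [0, 1]        *)
(* matter.                                                                    *)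
Definition is_ifs (R : realType) (I : finType) (phi : I -> R -> R) : Prop :=
  [/\ (1 < #|I|)%N,
      forall i, phi i @` `[0, 1] `<=` `[0, 1],
      forall i, {in `[0, 1] &, injective (phi i)},
      exists2 rho : R, 0 < rho < 1 &
        forall i, {in `[0, 1] &, forall x y,
          `|phi i x - phi i y| <= rho * `|x - y|}
    & forall i j, i != j ->
        (phi i @` `[0, 1]) `&` (phi j @` `[0, 1]) = set0].

Definition is_cantor_set (R : realType) (I : finType) (phi : I -> R -> R)
    (K : set R) : Prop :=
  [/\ K !=set0, compact K, K `<=` `[0, 1]
    & K = \bigcup_(i in [set: I]) (phi i @` K)].

Definition analytic_at (R : realType) (g : R -> R) (x : R) : Prop :=
  exists a : nat -> R, \forall y \near x,
    pseries a (y - x) @ \oo --> g y.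

Definition analytic_on_01 (R : realType) (f : R -> R) : Prop :=
  exists (V : set R) (g : R -> R),
    [/\ open V, `[0, 1] `<=` V, forall x, V x -> analytic_at g x
      & {in `[0, 1], f =1 g}].

Lemma computes_fun (M : turing_machine) (p w1 w2 : seq bool) :
  computes M p w1 -> computes M p w2 -> w1 = w2.
Proof.
have stop m (c : config M) : tm_halting c.1 -> iter m (@step M) c = c.
  by move=> hc; elim: m => //= m ->; rewrite /step hc.
move=> [n1 [h1 <-]] [n2 [h2 <-]]; congr output.
wlog le12 : n1 n2 h1 h2 / (n1 <= n2)%N.
  move=> H; case/orP: (leq_total n1 n2) => le; first exact: H.
  exact/esym/H.
by rewrite -(subnK le12) iterD (stop _ _ h1).
Qed.

Lemma delimit_inj (ds1 ds2 s1 s2 : seq bool) :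
  delimit ds1 ++ s1 = delimit ds2 ++ s2 -> ds1 = ds2 /\ s1 = s2.
Proof.
rewrite /delimit; elim: ds1 ds2 => [|b1 ds1 IH] [|b2 ds2] //=; first by case.
by case=> -> /IH[-> ->].
Qed.

Lemma encode_inj : injective encode.
Proof.
have encodeE x s : encode (x :: s) =
    x.1.1 :: delimit x.1.2 ++ (delimit x.2 ++ encode s).
  by rewrite /encode /encode_fraction [LHS]/= -catA.
elim=> [|[[b1 n1] d1] s1 IH] [|[[b2 n2] d2] s2] //.
by rewrite !encodeE => -[-> /delimit_inj[-> /delimit_inj[-> /IH ->]]].
Qed.

Lemma produces_fun (R : realType) (U : turing_machine) (p : seq bool)
    (F1 F2 : set R) : produces U p F1 -> produces U p F2 -> F1 = F2.
Proof.
move=> [s1 [_ c1 ->]] [s2 [_ c2 ->]].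
by rewrite (encode_inj (computes_fun c1 c2)).
Qed.

(* Main.v *)
Require Import Defs.
From HB Require Import structures.
From mathcomp Require Import all_boot all_order all_algebra.
From mathcomp Require Import all_classical all_reals all_analysis.
From mathcomp Require Import zify ring lra.
Import Order.TTheory GRing.Theory Num.Theory.
Import numFieldNormedType.Exports.

(** For accuracy [2^-L] it suffices to know every map up to a bounded multiple
    of [2^-L] on the grid of mesh [2^-L].  By compactness, [0, 1] is covered by
    finitely many charts on which each map is within [O(2^-d)] of a polynomial
    of degree [< d] with bounded coefficients in a variable of [[0, 1/2]]; with
    [d = O(L)] coefficients of [O(L)] bits each, this is [O(L^2)] bits in all.
    Horner's rule in fixed-point arithmetic evaluates such a polynomial with a
    rounding error of [O(1)] grid steps, since each step halves the previous
    error, and contraction keeps the error of [O(L)] composed maps at [O(1)]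
    grid steps.  A fixed machine can thus rebuild an approximation of the
    Cantor set from these bits, and the universal machine simulates it. *)

Set Implicit Arguments.
Unset Strict Implicit.
Unset Printing Implicit Defensive.

Local Open Scope nat_scope.

(** * While programs and Turing machines *)

(** An upper bound on the complexity calls for an actual machine, and a program [desc ++ p] has a
    prefix of constant length only if the machine is fixed independently of the accuracy. This
    machine is obtained by compilation: primitive recursive functions become while programs on unary
    counters, and these become multitape machines. Only the length of [p] counts, so neither the
    running time nor the exponentially many output points matter. The accuracy is not written in
    [p]: the length of [p] is a fixed multiple of [L ^ 2], from which [L] is recovered. One constant
    [A] fixes three sizes: [A * L] is the number of coefficients per polynomial, the number of bits
    per coefficient and the number of composed maps. The machine computes with natural numbers, so a
    signed coefficient is stored as its positive and its negative part. *)

Inductive op := OInc of nat | ODec of nat | ORead of nat | OEmit of nat.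

Inductive cmd :=
  | CSkip | COp of op | CSeq of cmd & cmd | CWhile of nat & cmd.

Definition upd (f : nat -> nat) (r v : nat) : nat -> nat :=
  fun x => if x == r then v else f x.

Definition store : Type := (nat -> nat) * seq bool * seq bool.

(** [ORead] also records, in the next register, that a bit was found; at the end of the input
    nothing changes, and a loop can detect this. [OEmit] prepends, so a word is emitted from its
    last bit. *)
Definition run_op (o : op) (s : store) : store :=
  let: (f, inp, out) := s in
  match o with
  | OInc r => (upd f r (f r).+1, inp, out)
  | ODec r => (upd f r (f r).-1, inp, out)
  | ORead r =>
      if inp is x :: inp' then
        (upd (upd f r (f r + x)) r.+1 (f r.+1).+1, inp', out)
      else s
  | OEmit r => (f, inp, (0 < f r) :: out)
  end.

Inductive exec : cmd -> store -> store -> Prop :=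
  | exec_skip s : exec CSkip s s
  | exec_op o s : exec (COp o) s (run_op o s)
  | exec_seq c1 c2 s1 s2 s3 :
      exec c1 s1 s2 -> exec c2 s2 s3 -> exec (CSeq c1 c2) s1 s3
  | exec_while0 r c s : s.1.1 r = 0 -> exec (CWhile r c) s s
  | exec_whileS r c s1 s2 s3 : 0 < s1.1.1 r ->
      exec c s1 s2 -> exec (CWhile r c) s2 s3 -> exec (CWhile r c) s1 s3.

(** [IInit] puts the zero marks on the register tapes; [IFinal] moves the output head from the blank
    before the output onto its first cell. *)
Inductive instr :=
  | IOp of op | IJump0 of nat & nat | IJump of nat | IInit | IFinal.

Fixpoint code (a : nat) (c : cmd) : seq instr :=
  match c with
  | CSkip => [::]
  | COp o => [:: IOp o]
  | CSeq c1 c2 => let l := code a c1 in l ++ code (a + size l) c2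
  | CWhile r c => let l := code a.+1 c in
      IJump0 r (a.+1 + (size l).+1) :: l ++ [:: IJump a]
  end.

Definition op_ok (n : nat) (o : op) : bool :=
  match o with
  | OInc r | ODec r | OEmit r => r < n
  | ORead r => r.+1 < n
  end.

Fixpoint cmd_ok (n : nat) (c : cmd) : bool :=
  match c with
  | CSkip => true
  | COp o => op_ok n o
  | CSeq c1 c2 => cmd_ok n c1 && cmd_ok n c2
  | CWhile r c => (r < n) && cmd_ok n c
  end.

Lemma cmd_okW n n' c : n <= n' -> cmd_ok n c -> cmd_ok n' c.
Proof.
move=> le; elim: c => //=.
- by case=> /= *; lia.
- by move=> c1 IH1 c2 IH2 /andP[/IH1 -> /IH2 ->].
- by move=> r c IH /andP[h /IH ->]; rewrite andbT; lia.
Qed.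

Section Machine.
Variables (P : seq instr) (n : nat).

Let sym : Type := option (bool + unit).
Let mark : sym := Some (inr tt).
(** Tape [ord0] holds the input, [ord_max] the output, and the [n] tapes in between the
    registers. *)
Let reg (r : nat) : 'I_n.+2 := inord r.+1.

Definition instr_act (c : instr) (rd : {ffun 'I_n.+2 -> sym}) (i : 'I_n.+2) :
    sym * direction :=
  match c with
  | IOp (OInc r) => (rd i, if i == reg r then Right else Stay)
  | IOp (ODec r) =>
      (rd i, if (i == reg r) && (rd i != mark) then Left else Stay)
  | IOp (ORead r) =>
      (rd i, if i == ord0 then (if rd ord0 is Some _ then Right else Stay)
             else if i == reg r then
               (if rd ord0 is Some (inl true) then Right else Stay)
             else if i == reg r.+1 then
               (if rd ord0 is Some _ then Right else Stay)
             else Stay)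
  | IOp (OEmit r) =>
      if i == ord_max then (Some (inl (rd (reg r) != mark)), Left)
      else (rd i, Stay)
  | IJump0 _ _ | IJump _ => (rd i, Stay)
  | IInit => if (i == ord0) || (i == ord_max) then (rd i, Stay)
             else (mark, Stay)
  | IFinal => (rd i, if i == ord_max then Right else Stay)
  end.

Definition instr_next (c : instr) (rd : {ffun 'I_n.+2 -> sym}) (q : nat) : nat :=
  match c with
  | IJump0 r t => if rd (reg r) == mark then t else q.+1
  | IJump t => t
  | _ => q.+1
  end.

(** The state is the program counter; the last state, just past the code, is the halting one. *)
Definition flat_machine : turing_machine :=
  @TuringMachine 'I_(size P).+1 unit n.+1 ord0
    (fun q => q == ord_max)
    (fun q rd => let c := nth IInit P q in
       (inord (instr_next c rd q), [ffun i => instr_act c rd i])).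

Notation M := flat_machine.

(* The value of a register is the distance of the head of its tape from the   *)
(* mark.                                                                      *)
Definition reg_tape (t : tape M) (v : nat) : Prop :=
  (forall i, nth None t.1 i = if i.+1 == v then mark else None) /\
  (forall i, nth None t.2 i = if (i == 0) && (v == 0) then mark else None).

Definition bits (w : seq bool) : seq (symbol M) := [seq Some (inl b) | b <- w].

(* The output is written from right to left, ahead of the head. *)
Definition represents (s : store) (t : {ffun 'I_n.+2 -> tape M}) : Prop :=
  [/\ forall i, nth None (t ord0).2 i = nth None (bits s.1.2) i,
      (t ord_max).1 = [::],
      nth None (t ord_max).2 0 = None,
      forall i, nth None (t ord_max).2 i.+1 = nth None (bits s.2) i
    & forall r, r < n -> reg_tape (t (reg r)) (s.1.1 r)].

(** Rewriting an unlisted blank lengthens the list, which is why the right-hand parts of tapes are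
    compared cell by cell with default [None]. *)
Lemma rewrite_stay (t : tape M) i :
  nth None (move Stay (write (read t) t)).2 i = nth None t.2 i.
Proof. by case: t => l [|x r] //=; case: i => //= i; rewrite nth_nil. Qed.

Lemma reg_inj r r' : r < n -> r' < n -> (reg r == reg r') = (r == r').
Proof. by move=> h h'; rewrite -val_eqE /= !inordK ?eqSS //; lia. Qed.

Lemma reg_neq0 r : r < n -> (reg r == ord0) = false.
Proof. by move=> h; rewrite -val_eqE /= !inordK //; lia. Qed.

Lemma reg_neq_max r : r < n -> (reg r == ord_max) = false.
Proof. by move=> h; rewrite -val_eqE /= !inordK //; lia. Qed.

Lemma reg_stay (t : tape M) v :
  reg_tape t v -> reg_tape (move Stay (write (read t) t)) v.
Proof. by case=> h1 h2; split => i; [exact: h1 | rewrite rewrite_stay]. Qed.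

Lemma read_nth (t : tape M) : read t = nth None t.2 0.
Proof. by rewrite nth0. Qed.

Lemma reg_right (t : tape M) v :
  reg_tape t v -> reg_tape (move Right (write (read t) t)) v.+1.
Proof.
case=> h1 h2; split=> -[|i] /=.
- by rewrite read_nth h2 eqSS /= eq_sym.
- by rewrite h1 eqSS.
- by rewrite nth_behead h2.
- by rewrite nth_behead h2.
Qed.

Lemma reg_left (t : tape M) v :
  reg_tape t v.+1 -> reg_tape (move Left (write (read t) t)) v.
Proof.
case=> h1 h2; split=> -[|i] /=.
- by rewrite nth_behead h1 eqSS.
- by rewrite nth_behead h1 eqSS.
- by rewrite -nth0 h1 eqSS eq_sym.
- case: i => [|i] /=; first by rewrite read_nth h2.
  by rewrite nth_behead h2.
Qed.

Lemma reg_zero (t : tape M) v : reg_tape t v -> (read t == mark) = (v == 0).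
Proof. by case=> h1 h2; rewrite read_nth h2 /=; case: (v == 0). Qed.

Definition act_tapes (c : instr) (t : {ffun 'I_n.+2 -> tape M}) :
    {ffun 'I_n.+2 -> tape M} :=
  [ffun i => let a := instr_act c [ffun i => read (t i)] i in
     move a.2 (write (a.1 : symbol M) (t i))].

Lemma step_instr (Q1 Q2 : seq instr) c (t : {ffun 'I_n.+2 -> tape M}) :
  P = Q1 ++ c :: Q2 ->
  step ((inord (size Q1), t) : config M) =
  (inord (instr_next c [ffun i => read (t i)] (size Q1)), act_tapes c t).
Proof.
move=> eP; rewrite /step /=.
have lt : size Q1 < size P by rewrite eP size_cat /=; lia.
have hq : nat_of_ord (inord (size Q1) : 'I_(size P).+1) = size Q1.
  by rewrite inordK //; lia.
have hc : nth IInit P (size Q1) = c by rewrite eP nth_cat ltnn subnn.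
case: ifPn => [/eqP h|_].
  by move: hq; rewrite h /=; lia.
rewrite hq hc; congr (_, _); apply/ffunP=> i; rewrite !ffunE.
by congr move.
Qed.

Lemma represents_stay c s (t : {ffun 'I_n.+2 -> tape M}) :
  (forall i : 'I_n.+2, instr_act c [ffun i => read (t i)] i = (read (t i), Stay)) ->
  represents s t -> represents s (act_tapes c t).
Proof.
move=> hc [h1 h2 h3 h4 h5].
by split=> *; rewrite ffunE hc ?rewrite_stay //; last exact/reg_stay/h5.
Qed.

Lemma represents_op o s (t : {ffun 'I_n.+2 -> tape M}) :
  op_ok n o -> represents s t -> represents (run_op o s) (act_tapes (IOp o) t).
Proof.
move=> ok [h1 h2 h3 h4 h5].
have max0 : (ord_max == ord0 :> 'I_n.+2) = false by [].
have maxr r : r < n -> (ord_max == reg r) = false.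
  by move=> h; rewrite eq_sym reg_neq_max.
have zr r : r < n -> (ord0 == reg r) = false.
  by move=> h; rewrite eq_sym reg_neq0.
case: s h1 h4 h5 => -[f inp] out /= h1 h4 h5.
case: o ok => [r|r|b|r] /= ok.
- split=> [i|||i|r' hr'] /=; rewrite ffunE /= ffunE ?zr ?maxr ?rewrite_stay //.
  rewrite reg_inj // /upd; case: eqP => [->|_].
    exact/reg_right/h5.
  exact/reg_stay/h5.
- split=> [i|||i|r' hr'] /=; rewrite ffunE /= ffunE ?zr ?maxr ?rewrite_stay //.
  rewrite reg_inj // /upd; case: eqP => [->|_] /=; last exact/reg_stay/h5.
  rewrite (reg_zero (h5 _ ok)); case E: (f r) => [|v] /=.
    by apply: reg_stay; rewrite -E; exact: h5.
  by apply: reg_left; rewrite -E; exact: h5.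
- have hb : b < n by lia.
  have neq : b != b.+1 by lia.
  have hrd : read (t ord0) = nth None (bits inp) 0 by rewrite read_nth h1.
  split=> [i|||i|r' hr'] /=; rewrite ffunE /= !ffunE ?max0 ?maxr ?rewrite_stay //.
  + case: inp h1 hrd => [|x inp] h1 hrd /=; rewrite hrd /=.
      by have /= := rewrite_stay (t ord0) i; rewrite hrd /= => ->.
    by rewrite nth_behead h1.
  + by case: inp {h1 hrd}.
  + rewrite reg_neq0 // !reg_inj // hrd.
    case: inp {h1 hrd} => [|x inp] /=.
      by rewrite !if_same; exact/reg_stay/h5.
    rewrite /upd; case: (eqVneq r' b) => [->|nb].
      rewrite (negbTE neq); case: x => /=.
        by rewrite addn1; exact/reg_right/h5.
      by rewrite addn0; exact/reg_stay/h5.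
    case: eqVneq => [->|nt]; first exact/reg_right/h5.
    exact/reg_stay/h5.
- split=> [i|||i|r' hr'] /=; rewrite ffunE /= ?ffunE ?eqxx ?rewrite_stay //=.
  + by rewrite h2.
  + by rewrite h2.
  + case: i => [|i] /=; first by rewrite (reg_zero (h5 _ ok)) lt0n.
    by rewrite nth_behead h4.
  + rewrite reg_neq_max //=; exact/reg_stay/h5.
Qed.

Definition reaches (q q' : nat) (s s' : store) : Prop :=
  forall t, represents s t -> exists k t',
    iter k (@step M) (inord q, t) = (inord q', t') /\ represents s' t'.

Lemma reaches_trans q1 q2 q3 s1 s2 s3 :
  reaches q1 q2 s1 s2 -> reaches q2 q3 s2 s3 -> reaches q1 q3 s1 s3.
Proof.
move=> h h' t /h[k [t' [e /h'[k' [t'' [e' r']]]]]].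
by exists (k' + k), t''; rewrite iterD e.
Qed.

Lemma reaches_refl q s : reaches q q s s.
Proof. by move=> t r; exists 0, t. Qed.

(** By induction on the execution rather than on the command, since a loop runs again on the same
    code. The address stays general because subcommands sit at other addresses. *)
Lemma code_reaches c s s' : exec c s s' -> cmd_ok n c ->
  forall Q1 Q2, P = Q1 ++ code (size Q1) c ++ Q2 ->
  reaches (size Q1) (size Q1 + size (code (size Q1) c)) s s'.
Proof.
elim=> {c s s'} [s|o s|c1 c2 s1 s2 s3 _ IH1 _ IH2|r c s s0
  |r c s1 s2 s3 s0 _ IH1 _ IH2] /= ok Q1 Q2 eP.
- by rewrite addn0; exact: reaches_refl.
- move=> t r; exists 1, (act_tapes (IOp o) t) => /=.
  rewrite (step_instr _ eP) /= addn1; split => //; exact: represents_op.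
- case/andP: ok => ok1 ok2; rewrite -catA in eP.
  apply: reaches_trans (IH1 ok1 _ _ eP) _.
  rewrite size_cat addnA -size_cat; apply: (IH2 ok2 _ Q2).
  by rewrite size_cat -catA.
(* The action of a jump on the tapes ignores its target, so the dummy target [0] will do. *)
- case/andP: ok => ok1 ok2 t rt; exists 1, (act_tapes (IJump0 r 0) t).
  rewrite /= (step_instr _ eP) /= ffunE.
  have [_ _ _ _ /(_ _ ok1) h] := rt.
  rewrite (reg_zero h) s0 eqxx /= size_cat /=; split.
    by congr (inord _, _); lia.
  by apply: represents_stay rt => i; rewrite /= ffunE.
- have okc := ok; case/andP: ok => ok1 ok2.
  apply: (@reaches_trans _ (size Q1).+1 _ _ s1).
    move=> t rt; exists 1, (act_tapes (IJump0 r 0) t).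
    rewrite /= (step_instr _ eP) /= ffunE.
    have [_ _ _ _ /(_ _ ok1) h] := rt.
    rewrite (reg_zero h) eqn0Ngt s0 /=; split => //.
    by apply: represents_stay rt => i; rewrite /= ffunE.
  set l := code (size Q1).+1 c in eP *.
  set j := IJump0 _ _ in eP.
  apply: reaches_trans.
    have := IH1 ok2 (rcons Q1 j) (IJump (size Q1) :: Q2).
    rewrite size_rcons; apply.
    by rewrite cat_rcons eP -/l /= -catA.
  apply: (@reaches_trans _ (size Q1) _ _ s2).
    move=> t rt; exists 1, (act_tapes (IJump 0) t).
    have eP' : P = (Q1 ++ j :: l) ++ IJump (size Q1) :: Q2.
      by rewrite eP -?catA /= -?catA.
    have es : (size Q1).+1 + size l = size (Q1 ++ j :: l).
      by rewrite size_cat /=; lia.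
    rewrite -/l es /= (step_instr _ eP') /=; split => //.
    by apply: represents_stay rt => i; rewrite /= ffunE.
  exact: IH2 okc _ _ eP.
Qed.

Lemma bit_prefix_nth (x : seq (symbol M)) w :
  (forall i, nth None x i = nth None (bits w) i) -> bit_prefix x = w.
Proof.
elim: w x => [|b w IH] [|y x] h //=.
- by move: (h 0) => /= ->.
- by move: (h 0).
- move: (h 0) => /= ->; congr cons; apply: IH => i; exact: (h i.+1).
Qed.

End Machine.

Lemma cmd_ok_ex c : exists n, cmd_ok n c.
Proof.
elim: c => [|o|c1 [n1 h1] c2 [n2 h2]|r c [n h]].
- by exists 0.
- by case: o => r; exists r.+2 => /=; lia.
- exists (maxn n1 n2); rewrite /= (cmd_okW _ h1) ?(cmd_okW _ h2) //; lia.
- exists (maxn n r.+1); rewrite /= (cmd_okW _ h) ?andbT; lia.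
Qed.

Lemma cmd_computes c : exists M : turing_machine, forall p w,
  (exists f inp, exec c (fun=> 0, p, [::]) (f, inp, w)) -> computes M p w.
Proof.
have [n ok] := cmd_ok_ex c.
pose P := IInit :: code 1 c ++ [:: IFinal].
exists (flat_machine P n) => p w [f [inp X]].
pose t0 := (@init (flat_machine P n) p).2.
have e0 : @init (flat_machine P n) p = (inord (size (@nil instr)), t0).
  by congr (_, _); apply: val_inj; rewrite /= inordK.
have eP0 : P = [::] ++ IInit :: (code 1 c ++ [:: IFinal]) by [].
have r1 : represents (fun=> 0, p, [::]) (act_tapes IInit t0).
  split=> [i|||i|r hr]; rewrite ffunE /=.
  - rewrite !ffunE /=; case: p {X t0 e0} => [|b p]; last by case: i.
    by case: i => //= i; rewrite nth_nil.
  - by rewrite eqxx /= !ffunE.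
  - by rewrite eqxx /= !ffunE.
  - by rewrite eqxx /= !ffunE /= !nth_nil.
  - rewrite reg_neq0 // reg_neq_max //= /t0 /init /= ffunE reg_neq0 //.
    by split=> -[|i] //=; rewrite nth_nil.
have eP1 : P = [:: IInit] ++ code (size [:: IInit]) c ++ [:: IFinal] by [].
have [k [t [ek rt]]] := code_reaches X ok eP1 r1.
exists (k.+2) => /=.
set M := flat_machine P n.
have ekk : iter k.+1 (@step M) (@init M p) =
    (inord (size (IInit :: code 1 c)), t).
  rewrite iterSr e0 -/M (step_instr _ eP0) /=.
  by rewrite ek /= add1n.
have eP2 : P = (IInit :: code 1 c) ++ IFinal :: [::] by [].
rewrite -[step (iter k _ _)]/(iter k.+1 (@step M) (@init M p)) ekk.
rewrite (step_instr _ eP2) /=; split.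
  by rewrite -val_eqE /= inordK /P /= ?size_cat /= ?addn1.
rewrite /output /= ffunE /= eqxx /=.
case: rt => _ _ _ h _; apply: bit_prefix_nth => i.
by rewrite nth_behead h.
Qed.

(** * Primitive recursive functions *)

Definition pexec (c : cmd) (f g : nat -> nat) : Prop :=
  forall inp out, exec c (f, inp, out) (g, inp, out).

Lemma pexec_eq c f g g' : pexec c f g -> g = g' -> pexec c f g'.
Proof. by move=> ? <-. Qed.

Lemma pexec_seq c1 c2 f1 f2 f3 :
  pexec c1 f1 f2 -> pexec c2 f2 f3 -> pexec (CSeq c1 c2) f1 f3.
Proof. by move=> h1 h2 i o; exact: exec_seq (h1 i o) (h2 i o). Qed.

Lemma pexec_inc r f : pexec (COp (OInc r)) f (upd f r (f r).+1).
Proof. by move=> i o; exact: (exec_op (OInc r) (f, i, o)). Qed.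

Lemma pexec_dec r f : pexec (COp (ODec r)) f (upd f r (f r).-1).
Proof. by move=> i o; exact: (exec_op (ODec r) (f, i, o)). Qed.

Lemma pexec_while0 r c f : f r = 0 -> pexec (CWhile r c) f f.
Proof. by move=> h i o; exact: exec_while0. Qed.

Lemma pexec_whileS r c f1 f2 f3 : 0 < f1 r ->
  pexec c f1 f2 -> pexec (CWhile r c) f2 f3 -> pexec (CWhile r c) f1 f3.
Proof. by move=> h h1 h2 i o; exact: exec_whileS (h1 i o) (h2 i o). Qed.

Ltac upd_cases :=
  apply/funext => ?; rewrite /upd;
  repeat match goal with
  | |- context [?a == ?b] => case: (eqVneq a b) => ?
  end; subst; try reflexivity; try congruence; try lia.

Definition clear (r : nat) : cmd := CWhile r (COp (ODec r)).

Lemma pexec_clear r f : pexec (clear r) f (upd f r 0).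
Proof.
move: {2}(f r) (erefl (f r)) => v; elim: v f => [|v IH] f fr.
  by apply: pexec_eq (pexec_while0 _ fr) _; upd_cases.
apply: pexec_whileS (pexec_dec _ _) _; first by rewrite fr.
by apply: pexec_eq (IH _ _) _; [rewrite /upd eqxx fr | upd_cases].
Qed.

Definition transfer (r t : nat) : cmd :=
  CWhile r (CSeq (COp (ODec r)) (COp (OInc t))).

Lemma pexec_transfer r t f : r != t ->
  pexec (transfer r t) f (upd (upd f t (f t + f r)) r 0).
Proof.
move=> rt; move: {2}(f r) (erefl (f r)) => v; elim: v f => [|v IH] f fr.
  by apply: pexec_eq (pexec_while0 _ fr) _; rewrite fr; upd_cases.
apply: pexec_whileS (pexec_seq (pexec_dec _ _) (pexec_inc _ _)) _.
  by rewrite fr.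
apply: pexec_eq (IH _ _) _; first by rewrite /upd eqxx (negbTE rt) fr.
by upd_cases.
Qed.

Definition duplicate (r t u : nat) : cmd :=
  CWhile r (CSeq (COp (ODec r)) (CSeq (COp (OInc t)) (COp (OInc u)))).

Lemma pexec_duplicate r t u f : r != t -> r != u -> t != u ->
  pexec (duplicate r t u) f
    (upd (upd (upd f t (f t + f r)) u (f u + f r)) r 0).
Proof.
move=> rt ru tu; move: {2}(f r) (erefl (f r)) => v; elim: v f => [|v IH] f fr.
  by apply: pexec_eq (pexec_while0 _ fr) _; rewrite fr; upd_cases.
apply: pexec_whileS
  (pexec_seq (pexec_dec _ _) (pexec_seq (pexec_inc _ _) (pexec_inc _ _))) _.
  by rewrite fr.
apply: pexec_eq (IH _ _) _.
  by rewrite /upd eqxx (negbTE rt) (negbTE ru) fr.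
by upd_cases.
Qed.

Fixpoint clear_range (r n : nat) : cmd :=
  if n is n'.+1 then CSeq (clear r) (clear_range r.+1 n') else CSkip.

Lemma pexec_clear_range r n f :
  pexec (clear_range r n) f (fun x => if r <= x < r + n then 0 else f x).
Proof.
elim: n r f => [|n IH] r f /=.
  move=> i o; suff -> : (fun x => if r <= x < r + 0 then 0 else f x) = f.
    exact: exec_skip.
  by apply/funext => x; case: ifP => //; lia.
apply: pexec_eq (pexec_seq (pexec_clear _ _) (IH _ _)) _.
apply/funext => x; rewrite /upd; case: eqP => [->|h].
  by case: ifP => //; case: ifP => //; lia.
by case: ifP; case: ifP => //; lia.
Qed.

(** Functions of a list need no arity: absent arguments read as 0. In [pr_rec] the counter and the
    accumulator are pushed in front of the environment, whose indices shift by two. *)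
Inductive pr : (seq nat -> nat) -> Prop :=
  | pr_zero : pr (fun=> 0)
  | pr_var i : pr (fun s => nth 0 s i)
  | pr_succ f : pr f -> pr (fun s => (f s).+1)
  | pr_comp f gs : pr f -> (forall g, List.In g gs -> pr g) ->
      pr (fun s => f [seq g s | g <- gs])
  | pr_rec n f g : pr n -> pr f -> pr g ->
      pr (fun s => iteri (n s) (fun i a => g (i :: a :: s)) (f s)).

(** A stack discipline: [h] is the first free register, everything from [h] on is zero, and only [h]
    is changed in the end. Compiled pieces can thus be chained. *)
Definition compilable (f : seq nat -> nat) : Prop :=
  forall (l : seq nat) (h : nat), all (fun r => r < h) l ->
  exists c, forall m, (forall r, h <= r -> m r = 0) ->
    pexec c m (upd m h (f [seq m r | r <- l])).

Lemma map_env (l : seq nat) h (m m' : nat -> nat) : all (fun r => r < h) l ->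
  (forall r, r < h -> m r = m' r) -> [seq m r | r <- l] = [seq m' r | r <- l].
Proof. by move=> /allP hl e; apply/eq_in_map => r /hl /e. Qed.

Lemma all_lt_trans (l : seq nat) h h' :
  h <= h' -> all (fun r => r < h) l -> all (fun r => r < h') l.
Proof. by move=> le; apply: sub_all => r; lia. Qed.

Lemma compilable_seq (gs : seq (seq nat -> nat)) :
  (forall g, List.In g gs -> compilable g) ->
  forall (l : seq nat) (h : nat), all (fun r => r < h) l ->
  exists c, forall m, (forall r, h <= r -> m r = 0) ->
    pexec c m (fun x => if h <= x then
      nth 0 [seq g [seq m r | r <- l] | g <- gs] (x - h) else m x).
Proof.
elim: gs => [|g gs IH] hgs l h hl.
  exists CSkip => m hm.
  apply: (@pexec_eq _ _ m); first by move=> i o; exact: exec_skip.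
  by apply/funext => x; rewrite nth_nil; case: ifP => // /hm.
have [c hc] := hgs g (or_introl erefl) l h hl.
have hl' : all (fun r => r < h.+1) l by exact: all_lt_trans hl.
have [c' hc'] := IH (fun g hg => hgs g (or_intror hg)) l h.+1 hl'.
exists (CSeq c c') => m hm; apply: pexec_seq (hc _ hm) _.
set v := g _; have e : [seq upd m h v r | r <- l] = [seq m r | r <- l].
  by apply: map_env hl _ => r hr; rewrite /upd ifN //; lia.
have z r : h < r -> upd m h v r = 0.
  by move=> hr; rewrite /upd ifN ?hm //; lia.
apply: pexec_eq (hc' _ z) _; rewrite e; apply/funext => x.
case: (ltngtP h x) => hx.
- by rewrite (_ : x - h = (x - h.+1).+1); [|lia].
- by rewrite /upd ifN //; lia.
- by rewrite -hx /upd eqxx subnn.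
Qed.

Lemma pr_compilable f : pr f -> compilable f.
Proof.
elim=> {f} [|i|f _ IH|f gs _ IHf _ IHg|n f g _ IHn _ IHf _ IHg] l h hl.
- exists CSkip => m hm i o; suff -> : upd m h 0 = m by exact: exec_skip.
  by apply/funext => x; rewrite /upd; case: eqP => // ->; rewrite hm.
- case: (ltnP i (size l)) => hi; last first.
    exists CSkip => m hm.
    rewrite nth_default ?size_map // => j o.
    suff -> : upd m h 0 = m by exact: exec_skip.
    by apply/funext => x; rewrite /upd; case: eqP => // ->; rewrite hm.
  set r := nth 0 l i; have hr : r < h by exact: (all_nthP 0 hl).
  (* Copying empties the source, so a second copy goes to [h.+1] and is moved back. *)
  exists (CSeq (duplicate r h h.+1) (transfer h.+1 r)) => m hm.
  apply: pexec_eq (pexec_seq (pexec_duplicate _ _ _ _) (pexec_transfer _ _)) _;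
    try lia.
  rewrite (nth_map 0) // -/r; have := hm h; have := hm h.+1.
  move=> /(_ (leqnSn _)) h1 /(_ (leqnn _)) h2.
  by upd_cases; rewrite ?h1 ?h2; lia.
- have [c hc] := IH l h hl; exists (CSeq c (COp (OInc h))) => m hm.
  apply: pexec_eq (pexec_seq (hc m hm) (pexec_inc _ _)) _.
  by upd_cases.
(* Register [h] stays free for the result; the values of [gs], then that of [f], are computed above
   it. *)
- have hl1 : all (fun r => r < h.+1) l by exact: all_lt_trans hl.
  have [c1 hc1] := compilable_seq IHg hl1.
  pose l' := iota h.+1 (size gs).
  have hl' : all (fun r => r < h.+1 + size gs) l'.
    by apply/allP => r; rewrite mem_iota; lia.
  have [c2 hc2] := IHf l' _ hl'.
  exists (CSeq c1 (CSeq c2 (CSeq (clear_range h.+1 (size gs))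
    (transfer (h.+1 + size gs) h)))) => m hm.
  have hm1 r : h < r -> m r = 0 by move=> hr; apply: hm; lia.
  apply: pexec_seq (hc1 m hm1) _.
  set env := [seq m r | r <- l]; set m1 := (X in pexec _ X _).
  have hm2 r : h.+1 + size gs <= r -> m1 r = 0.
    by move=> hr; rewrite /m1 ifT ?nth_default ?size_map; lia.
  apply: pexec_seq (hc2 m1 hm2) _.
  have -> : [seq m1 r | r <- l'] = [seq g env | g <- gs].
    apply: (@eq_from_nth _ 0); rewrite ?size_map ?size_iota // => j hj.
    rewrite (nth_map 0) ?size_iota // nth_iota // /m1 ifT; last by lia.
    by congr nth; lia.
  set v := f _.
  apply: pexec_eq (pexec_seq (pexec_clear_range _ _ _) (pexec_transfer _ _)) _.
    by lia.
  apply/funext => x; rewrite /upd.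
  have -> : (h == h.+1 + size gs) = false by lia.
  case: (eqVneq x (h.+1 + size gs)) => [->|hx].
    by rewrite ifN ?hm //; lia.
  case: (eqVneq x h) => [_|hx2].
    rewrite ltnn /= eqxx ifN; last by lia.
    by rewrite /m1 ltnn hm.
  case: ifP => hx3; first by rewrite hm //; lia.
  by rewrite /m1; case: ifP => // hx4; rewrite nth_default ?size_map ?hm //; lia.
- have hl1 : all (fun r => r < h.+1) l by exact: all_lt_trans hl.
  have hl3 : all (fun r => r < h.+3) [:: h.+2, h & l].
    by rewrite /= (all_lt_trans _ hl) ?andbT; lia.
  have [c1 hc1] := IHf l h hl.
  have [c2 hc2] := IHn l h.+1 hl1.
  have [c3 hc3] := IHg _ h.+3 hl3.
  pose body := CSeq c3 (CSeq (clear h) (CSeq (transfer h.+3 h)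
    (CSeq (COp (OInc h.+2)) (COp (ODec h.+1))))).
  exists (CSeq c1 (CSeq c2 (CSeq (CWhile h.+1 body) (clear h.+2)))) => m hm.
  set env := [seq m r | r <- l].
  pose A j := iteri j (fun i a => g (i :: a :: env)) (f env).
  (* The loop invariant: after [j] rounds with [k] to go, [h] holds the accumulator, [h.+1] the
     countdown and [h.+2] the index. *)
  pose S j k := upd (upd (upd m h (A j)) h.+1 k) h.+2 j.
  have step j k : pexec body (S j k.+1) (S j.+1 k).
    have z r : h.+3 <= r -> S j k.+1 r = 0.
      by move=> hr; rewrite /S /upd !ifN ?hm //; lia.
    have e : [seq S j k.+1 r | r <- [:: h.+2, h & l]] = [:: j, A j & env].
      rewrite /= {1 2}/S /upd eqxx eqxx !ifN; try lia.
      congr [:: _, _ & _]; apply: map_env hl _ => r hr.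
      by rewrite /S /upd !ifN //; lia.
    apply: pexec_eq (pexec_seq (hc3 _ z) (pexec_seq (pexec_clear _ _)
      (pexec_seq (pexec_transfer _ _)
        (pexec_seq (pexec_inc _ _) (pexec_dec _ _))))) _; first by lia.
    rewrite e -[g _]/(A j.+1) /S; have := hm h.+3; have := hm h.
    move=> /(_ (leqnn _)) h1 /(_ (ltac:(lia))) h2.
    by upd_cases.
  have loop k j : pexec (CWhile h.+1 body) (S j k) (S (j + k) 0).
    elim: k j => [|k IH] j.
      by rewrite addn0; apply: pexec_while0; rewrite /S /upd eqxx ifN //; lia.
    rewrite addnS -addSn; apply: pexec_whileS (step j k) (IH _).
    by rewrite /S /upd eqxx ifN //; lia.
  apply: pexec_seq (hc1 m hm) _; rewrite -/env.
  apply: pexec_seq (hc2 _ _) _.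
    by move=> r hr; rewrite /upd ifN ?hm //; lia.
  set env' := [seq _ | r <- l].
  have -> : env' = env.
    by apply: map_env hl _ => r hr; rewrite /upd ifN //; lia.
  set m2 := upd _ _ _; have -> : m2 = S 0 (n env).
    rewrite /m2 /S /A /=; have := hm h.+2 (ltac:(lia)) => h2.
    by upd_cases.
  apply: pexec_eq (pexec_seq (loop _ _) (pexec_clear _ _)) _.
  rewrite add0n /S -/(A _); have := hm h.+2 (ltac:(lia)) => h2.
  have := hm h.+1 (ltac:(lia)) => h1.
  by rewrite -/(A (n env)); upd_cases.
Qed.

Lemma pr_eq f g : pr f -> f =1 g -> pr g.
Proof. by move=> h /funext <-. Qed.

(* The code [x] of a word [w] satisfies [binary (true :: w) = x.+1], so that  *)
(* [0] codes the empty word.                                                  *)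
Definition wcode (w : seq bool) : nat :=
  foldl (fun x (b : bool) => x.*2 + b.+1) 0 w.

Lemma wcode_rcons w b : wcode (rcons w b) = (wcode w).*2 + b.+1.
Proof. by rewrite /wcode -cats1 foldl_cat. Qed.

Lemma pr_const k : pr (fun=> k).
Proof. by elim: k => [|k IH]; [exact: pr_zero | exact: pr_succ]. Qed.

Lemma pr_comp1 (h : nat -> nat) f :
  pr (fun s => h (nth 0 s 0)) -> pr f -> pr (fun s => h (f s)).
Proof.
move=> hh hf; apply: (pr_eq (pr_comp (gs := [:: f]) hh _)) => // g.
by case=> [<-|].
Qed.

Lemma pr_comp2 (h : nat -> nat -> nat) f1 f2 :
  pr (fun s => h (nth 0 s 0) (nth 0 s 1)) -> pr f1 -> pr f2 ->
  pr (fun s => h (f1 s) (f2 s)).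
Proof.
move=> hh h1 h2; apply: (pr_eq (pr_comp (gs := [:: f1; f2]) hh _)) => // g.
by case=> [<-|[<-|]].
Qed.

Lemma pr_comp3 (h : nat -> nat -> nat -> nat) f1 f2 f3 :
  pr (fun s => h (nth 0 s 0) (nth 0 s 1) (nth 0 s 2)) ->
  pr f1 -> pr f2 -> pr f3 -> pr (fun s => h (f1 s) (f2 s) (f3 s)).
Proof.
move=> hh h1 h2 h3.
apply: (pr_eq (pr_comp (gs := [:: f1; f2; f3]) hh _)) => // g.
by case=> [<-|[<-|[<-|]]].
Qed.

Lemma pr_comp4 (h : nat -> nat -> nat -> nat -> nat) f1 f2 f3 f4 :
  pr (fun s => h (nth 0 s 0) (nth 0 s 1) (nth 0 s 2) (nth 0 s 3)) ->
  pr f1 -> pr f2 -> pr f3 -> pr f4 ->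
  pr (fun s => h (f1 s) (f2 s) (f3 s) (f4 s)).
Proof.
move=> hh h1 h2 h3 h4.
apply: (pr_eq (pr_comp (gs := [:: f1; f2; f3; f4]) hh _)) => // g.
by case=> [<-|[<-|[<-|[<-|]]]].
Qed.

Lemma pr_iteri n f g F : pr n -> pr f -> pr g ->
  (forall s, F s = iteri (n s) (fun i a => g (i :: a :: s)) (f s)) -> pr F.
Proof. by move=> hn hf hg e; apply: pr_eq (pr_rec hn hf hg) _ => s; rewrite e. Qed.

Lemma pr_add f g : pr f -> pr g -> pr (fun s => f s + g s).
Proof.
move=> hf hg; apply: (pr_iteri hf hg (pr_succ (pr_var 1))) => s /=.
by elim: (f s) => //= n <-; rewrite addSn.
Qed.

Lemma pr_mul f g : pr f -> pr g -> pr (fun s => f s * g s).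
Proof.
apply: pr_comp2.
apply: (pr_iteri (pr_var 0) pr_zero (pr_add (pr_var 1) (pr_var 3))) => s /=.
by elim: (nth 0 s 0) => //= n <-; rewrite mulSn addnC.
Qed.

Lemma pr_pred f : pr f -> pr (fun s => (f s).-1).
Proof.
move=> hf; apply: (pr_iteri hf pr_zero (pr_var 0)) => s /=.
by case: (f s).
Qed.

Lemma pr_sub f g : pr f -> pr g -> pr (fun s => f s - g s).
Proof.
move=> hf hg; apply: (pr_iteri hg hf (pr_pred (pr_var 1))) => s /=.
by elim: (g s) => [|n /= <-]; rewrite ?subn0 ?subnS.
Qed.

Lemma pr_exp f g : pr f -> pr g -> pr (fun s => f s ^ g s).
Proof.
apply: pr_comp2.
apply: (pr_iteri (pr_var 1) (pr_const 1) (pr_mul (pr_var 2) (pr_var 1))) => s /=.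
by elim: (nth 0 s 1) => //= n <-; rewrite expnS.
Qed.

Lemma pr_leq f g : pr f -> pr g -> pr (fun s => nat_of_bool (f s <= g s)).
Proof.
move=> hf hg; apply: pr_eq (pr_sub (pr_const 1) (pr_sub hf hg)) _ => s.
by case: leqP; lia.
Qed.

Lemma pr_min f g : pr f -> pr g -> pr (fun s => minn (f s) (g s)).
Proof.
move=> hf hg; apply: pr_eq (pr_sub hf (pr_sub hf hg)) _ => s.
by lia.
Qed.

(** By recursion on the dividend: the quotient grows by one exactly when the next multiple of the
    divisor is reached. The factor [1 <= d] enforces the convention that division by 0 gives 0. *)
Lemma pr_div f g : pr f -> pr g -> pr (fun s => f s %/ g s).
Proof.
apply: pr_comp2.
apply: (pr_iteri (pr_var 0) (pr_const 0) (g := fun s => nth 0 s 1 +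
  ((nth 0 s 3 * (nth 0 s 1).+1 <= (nth 0 s 0).+1) * (1 <= nth 0 s 3)))).
  apply: pr_add (pr_var 1) (pr_mul (pr_leq _ (pr_succ (pr_var 0)))
    (pr_leq (pr_const 1) (pr_var 3))).
  exact: pr_mul (pr_var 3) (pr_succ (pr_var 1)).
move=> s /=; set d := nth 0 s 1; elim: (nth 0 s 0) => [|n /= <-].
  by rewrite div0n.
case: d => [|d]; first by rewrite !divn0 muln0.
rewrite muln1 mulnC -leq_divRL // divnS // addnC; congr (_ + _).
by case: (d.+1 %| n.+1); rewrite ?addn0 ?ltnn ?addn1 ?leqnn.
Qed.

Lemma pr_mod f g : pr f -> pr g -> pr (fun s => f s %% g s).
Proof.
move=> hf hg; apply: pr_eq (pr_sub hf (pr_mul (pr_div hf hg) hg)) _ => s.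
by rewrite {1}(divn_eq (f s) (g s)) addKn.
Qed.

(** In the coding [wcode], reading a bit [b] sends [x] to [2 * x + b + 1]. Conversely, after
    subtracting 1, the parity is the last bit and the half codes the rest, which suits the emission
    of words from their last bit. *)
Theorem pr_machine f : pr f -> exists M : turing_machine, forall p w,
  f [:: wcode p] = wcode w -> computes M p w.
Proof.
move=> hf.
pose fin (s : seq nat) := nth 0 s 0 + nth 0 s 0 + (nth 0 s 1).+1.
have hin : pr fin.
  exact: pr_add (pr_add (pr_var 0) (pr_var 0)) (pr_succ (pr_var 1)).
have hodd : pr (fun s => nth 0 s 0 %% 2) by exact: pr_mod (pr_var 0) (pr_const 2).
have hhalf : pr (fun s => nth 0 s 0 %/ 2) by exact: pr_div (pr_var 0) (pr_const 2).
have [c0 hc0] := pr_compilable hin (isT : all (fun r => r < 3) [:: 0; 1]).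
have [cf hcf] := pr_compilable hf (isT : all (fun r => r < 1) [:: 0]).
have [c1 hc1] := pr_compilable hodd (isT : all (fun r => r < 2) [:: 1]).
have [c2 hc2] := pr_compilable hhalf (isT : all (fun r => r < 3) [:: 1]).
pose rd := CSeq (COp (ODec 2)) (CSeq c0 (CSeq (clear 0) (CSeq (clear 1)
  (transfer 3 0)))).
pose em1 := CSeq (COp (ODec 1)) (CSeq c1 c2).
pose em2 := CSeq (clear 1) (CSeq (clear 2) (transfer 3 1)).
pose rdl := CWhile 2 (CSeq rd (COp (ORead 1))).
pose eml := CWhile 1 (CSeq em1 (CSeq (COp (OEmit 2)) em2)).
have [M hM] := cmd_computes (CSeq (CSeq (COp (ORead 1)) rdl) (CSeq cf eml)).
exists M => p w e; apply: hM.
pose Z x := upd (fun=> 0) 0 x.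
pose E x y := upd (Z x) 1 y.
pose B x (b : bool) := upd (E x b) 2 1.
pose G x y (b : bool) := upd (upd (E x (y.*2 + b)) 2 b) 3 y.
have read_step x b : pexec rd (B x b) (Z (x.*2 + b.+1)).
  apply: pexec_eq (pexec_seq (pexec_dec _ _) (pexec_seq (hc0 _ _) (pexec_seq
    (pexec_clear _ _) (pexec_seq (pexec_clear _ _) (pexec_transfer _ _))))) _.
  - by move=> [|[|[|r]]].
  - by [].
  - by rewrite /= /fin /= {2 3 4}/upd /= -addnn /B /E /Z; upd_cases.
have reading p' x o : exec rdl (run_op (ORead 1) (Z x, p', o))
    (Z (foldl (fun x (b : bool) => x.*2 + b.+1) x p'), [::], o).
  elim: p' x => [|b p' IH] x; first exact: exec_while0.
  have -> : run_op (ORead 1) (Z x, b :: p', o) = (B x b, p', o).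
    by congr (_, _, _); rewrite /B /E /Z; upd_cases.
  apply: exec_whileS (IH _) => //.
  exact: exec_seq (read_step x b p' o) (exec_op _ _).
have emit1 x y (b : bool) : pexec em1 (E x (y.*2 + b.+1)) (G x y b).
  apply: pexec_eq (pexec_seq (pexec_dec _ _)
    (pexec_seq (hc1 _ _) (hc2 _ _))) _.
  - by move=> [|[|r]].
  - by move=> [|[|[|r]]].
  - have e1 : (y.*2 + b) %% 2 = b by rewrite modn2 oddD odd_double oddb.
    have e2 : (y.*2 + b) %/ 2 = y by rewrite divn2 addnC half_bit_double.
    rewrite /G /= {2 5 6}/upd /= {3}/upd /= addnS /= e1.
    by rewrite /E /Z; upd_cases.
have emit2 x y (b : bool) : pexec em2 (G x y b) (E x y).
  apply: pexec_eq (pexec_seq (pexec_clear _ _)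
    (pexec_seq (pexec_clear _ _) (pexec_transfer _ _))) _ => //.
  by rewrite /G /E /Z; upd_cases.
have emitting w' x inp o : exec eml (E x (wcode w'), inp, o)
   (E x 0, inp, w' ++ o).
  elim/last_ind: w' o => [|w' b IH] o; first exact: exec_while0.
  rewrite wcode_rcons cat_rcons.
  apply: exec_whileS (IH (b :: o)); first by rewrite /= /E /upd /=; lia.
  apply: exec_seq (emit1 x _ b inp o) (exec_seq (exec_op _ _) _).
  by have := emit2 x (wcode w') b inp (b :: o); case: (b).
exists (E (wcode p) 0), [::].
have -> : (fun=> 0 : nat) = Z 0 by rewrite /Z; upd_cases.
apply: exec_seq (exec_seq (exec_op _ _) (reading p 0 [::])) _.
rewrite -/(wcode p).
have hz r : 1 <= r -> Z (wcode p) r = 0 by case: r.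
have := hcf _ hz [::] [::]; rewrite /= e => X.
by apply: exec_seq X _; have := emitting w (wcode p) [::] [::]; rewrite cats0.
Qed.

(** * The decoder *)

Definition digit (w z j : nat) : nat := z %/ 2 ^ (w * j) %% 2 ^ w.

Lemma pr_digit f g h : pr f -> pr g -> pr h ->
  pr (fun s => digit (f s) (g s) (h s)).
Proof.
move=> hf hg hh.
apply: pr_mod; last by apply: pr_exp hf; exact: pr_const.
apply: pr_div hg _; apply: pr_exp (pr_const 2) _.
exact: pr_mul hf hh.
Qed.

(** The multiple [x] of [2 ^ (w * K)] leaves room for a leading one that fixes the length of the
    word without touching the digits. *)
Lemma digits_ex w K (a : nat -> nat) : (forall j, j < K -> a j < 2 ^ w) ->
  exists2 z, z < 2 ^ (w * K) &
    forall x j, j < K -> digit w (x * 2 ^ (w * K) + z) j = a j.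
Proof.
elim: K a => [|K IH] a ha; first by exists 0; rewrite ?muln0.
have [z hz dz] := IH (fun j => a j.+1) (fun j h => ha j.+1 h).
have h0 : a 0 < 2 ^ w by exact: ha.
have pw : 0 < 2 ^ w by rewrite expn_gt0.
exists (z * 2 ^ w + a 0); first by rewrite mulnS expnD; nia.
move=> x j hj.
have -> : x * 2 ^ (w * K.+1) + (z * 2 ^ w + a 0) =
    (x * 2 ^ (w * K) + z) * 2 ^ w + a 0.
  by rewrite mulnS expnD; lia.
case: j hj => [|j] hj; rewrite /digit.
  by rewrite muln0 expn0 divn1 modnMDl modn_small.
rewrite mulnS expnD divnMA divnMDl // (divn_small h0) addn0.
exact: dz.
Qed.

(** The word consists of the binary digits of [z] after the leading one, which stays implicit. *)
Lemma wcode_ex l z : 2 ^ l <= z < 2 ^ l.+1 ->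
  exists2 p, size p = l & (wcode p).+1 = z.
Proof.
elim: l z => [|l IH] z hz.
  by exists [::] => //; rewrite expn0 expn1 in hz; rewrite /wcode /=; lia.
have [|p sp ep] := IH z./2.
  move: hz; rewrite !expnS; lia.
exists (rcons p (odd z)); rewrite ?size_rcons ?sp // wcode_rcons.
by rewrite -[RHS]odd_double_half -ep; lia.
Qed.

(** One bit more than [L], because both the denominator and the right end of the grid are
    [2 ^ L]. *)
Definition bits_of (L k : nat) : seq bool :=
  [seq odd (k %/ 2 ^ (L - t)) | t <- iota 0 L.+1].

Lemma binary_bits_of L k : k < 2 ^ L.+1 -> binary (bits_of L k) = k.
Proof.
move=> hk.
suff H n : n <= L.+1 ->
    binary [seq odd (k %/ 2 ^ (L - t)) | t <- iota 0 n] = k %/ 2 ^ (L.+1 - n).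
  by rewrite /bits_of H // subnn divn1.
elim: n => [|n IH] hn; first by rewrite subn0 divn_small.
rewrite -(addn1 n) iotaD map_cat /binary foldl_cat -/(binary _) IH; last by lia.
have -> : L.+1 - n = (L - n).+1 by lia.
rewrite /= add0n expnSr divnMA divn2 (_ : L.+1 - (n + 1) = L - n); last by lia.
by rewrite addnC odd_double_half.
Qed.

Definition frac (L k : nat) : fraction := (false, bits_of L k, bits_of L (2 ^ L)).

Lemma wf_frac L k : wf_fraction (frac L k).
Proof.
by rewrite /wf_fraction /= binary_bits_of ?expn_gt0 // ltn_exp2l.
Qed.

Lemma fraction_val_frac (R : realType) L k : k <= 2 ^ L ->
  fraction_val R (frac L k) = (k%:R / 2 ^+ L)%R.
Proof.
move=> hk; rewrite /fraction_val /= expr0 mul1r.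
have h : 2 ^ L < 2 ^ L.+1 by rewrite ltn_exp2l.
by rewrite !binary_bits_of ?natrX //; lia.
Qed.

(** Word operations are carried out on codes: this is the effect on [wcode] of appending a bit, and
    the next two mirror [delimit] and [encode_fraction]. *)
Definition append_bit (x b : nat) : nat := x + x + b.+1.

Definition append_nat (L x k : nat) : nat :=
  append_bit (iteri L.+1 (fun t y =>
    append_bit (append_bit y 1) (k %/ 2 ^ (L - t) %% 2)) x) 0.

Definition append_frac (L x k : nat) : nat :=
  append_nat L (append_nat L (append_bit x 0) k) (2 ^ L).

Lemma append_bit_wcode w (b : bool) : append_bit (wcode w) b = wcode (rcons w b).
Proof. by rewrite wcode_rcons /append_bit addnn. Qed.

Lemma append_nat_wcode L w k :
  append_nat L (wcode w) k = wcode (w ++ delimit (bits_of L k)).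
Proof.
rewrite /append_nat /delimit /bits_of catA cats1 -append_bit_wcode.
congr append_bit.
elim: L.+1 => [|n IH]; first by rewrite /= cats0.
rewrite -(addn1 n) iotaD !map_cat flatten_cat catA addn1 [LHS]/= IH /= add0n.
by rewrite modn2 -[1]/(nat_of_bool true) !append_bit_wcode -!cats1 -catA.
Qed.

Lemma append_frac_wcode L w k :
  append_frac L (wcode w) k = wcode (w ++ encode_fraction (frac L k)).
Proof.
rewrite /append_frac -[0]/(nat_of_bool false) append_bit_wcode !append_nat_wcode.
by rewrite cat_rcons -catA.
Qed.

Lemma pr_append_bit f g : pr f -> pr g -> pr (fun s => append_bit (f s) (g s)).
Proof.
by move=> hf hg; apply: pr_add (pr_add hf hf) (pr_succ hg).
Qed.

Lemma pr_append_nat f g h : pr f -> pr g -> pr h ->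
  pr (fun s => append_nat (f s) (g s) (h s)).
Proof.
apply: pr_comp3; apply: pr_append_bit pr_zero.
apply: (pr_iteri (pr_succ (pr_var 0)) (pr_var 1) (g := fun s => append_bit
  (append_bit (nth 0 s 1) 1) (nth 0 s 4 %/ 2 ^ (nth 0 s 2 - nth 0 s 0) %% 2))) => //.
apply: pr_append_bit; first exact: pr_append_bit (pr_var 1) (pr_const 1).
apply: pr_mod (pr_const 2); apply: pr_div (pr_var 4) _.
exact: pr_exp (pr_const 2) (pr_sub (pr_var 2) (pr_var 0)).
Qed.

Lemma pr_append_frac f g h : pr f -> pr g -> pr h ->
  pr (fun s => append_frac (f s) (g s) (h s)).
Proof.
move=> hf hg hh; apply: (pr_append_nat hf); last exact: pr_exp (pr_const 2) hf.
exact: pr_append_nat hf (pr_append_bit hg pr_zero) hh.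
Qed.

Section Program.
Variables q m A : nat.

Definition fixed_horner (a : nat -> nat) (n base r D : nat) : nat :=
  iteri n (fun t y => a (base + t) + y * r %/ D) 0.

(* The block of [n] digits that holds the positive ([e = 0]) or negative      *)
(* ([e = 1]) parts of the coefficients of map [i] on chart [c].               *)
Definition block (n i c e : nat) : nat := ((i * m.+1 + c) * 2 + e) * n.

Lemma block_lt n i c e t : i < q -> c <= m -> e < 2 -> t < n ->
  block n i c e + t < 2 * q * m.+1 * n.
Proof.
move=> hi hc he ht; rewrite /block.
have h1 : i * m.+1 + c < q * m.+1.
  by apply: (@leq_trans (i.+1 * m.+1)); [rewrite mulSn; lia | rewrite leq_mul2r hi orbT].
have h2 : (i * m.+1 + c) * 2 + e < 2 * q * m.+1 by rewrite -mulnA; lia.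
apply: (@leq_trans (((i * m.+1 + c) * 2 + e).+1 * n)); first by rewrite mulSn; lia.
by rewrite leq_mul2r h2 orbT.
Qed.

(** Here [k / 2 ^ L = (c + 2 * s) / m] with [s = r / 2 ^ L.+1], so the variable [s] of chart [c]
    stays below 1/2. The end [k = 2 ^ L] gives [c = m], hence [m.+1] charts. Truncated subtraction
    and [minn] keep the result on the grid. *)
Definition grid_map (a : nat -> nat) (L i k : nat) : nat :=
  let n := A * L in
  let c := (k * m) %/ 2 ^ L in
  let r := (k * m) %% 2 ^ L in
  minn (2 ^ L) (fixed_horner a n (block n i c 0) r (2 ^ L.+1) -
                fixed_horner a n (block n i c 1) r (2 ^ L.+1)).

Definition grid_point (a : nat -> nat) (L u : nat) : nat :=
  iteri (A * L) (fun t k => grid_map a L (u %/ q ^ t %% q) k) 0.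

Definition grid_output (a : nat -> nat) (L : nat) : nat :=
  iteri (q ^ (A * L)) (fun u x => append_frac L x (grid_point a L u)) 0.

(** Two signs, [q] maps, [m.+1] charts, then [A * L] coefficients of [A * L] bits each; the factor
    [L ^ 2] is split off. *)
Definition data_factor : nat := 2 * q * m.+1 * A ^ 2.

(** For positive [q] and [A] the data lengths of distinct levels differ, so counting the thresholds
    up to [z] recovers [L]. As [L < 2 ^ L <= z], [z] rounds suffice. *)
Definition level (z : nat) : nat :=
  iteri z (fun i a => a + (2 ^ (data_factor * i.+1 ^ 2) <= z)) 0.

Definition decoder (s : seq nat) : nat :=
  let z := (nth 0 s 0).+1 in
  let L := level z in grid_output (digit (A * L) z) L.

(** The function argument [a] is specialised throughout to [digit (A * L) z], which turns each stage
    into a function of numbers only. *)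
Lemma pr_decoder : pr decoder.
Proof.
have pL f : pr f -> pr (fun s => level (f s)).
  apply: pr_comp1; apply: (pr_iteri (pr_var 0) pr_zero (g := fun s => nth 0 s 1
    + (2 ^ (data_factor * (nth 0 s 0).+1 ^ 2) <= nth 0 s 2))) => //.
  apply: pr_add (pr_var 1) (pr_leq _ (pr_var 2)); apply: pr_exp (pr_const 2) _.
  apply: pr_mul (pr_const _) (pr_exp (pr_succ (pr_var 0)) (pr_const 2)).
have pH f1 f2 f3 f4 : pr f1 -> pr f2 -> pr f3 -> pr f4 -> pr (fun s =>
    fixed_horner (digit (A * f1 s) (f2 s)) (A * f1 s) (f3 s) (f4 s) (2 ^ (f1 s).+1)).
  apply: (@pr_comp4 (fun L z b r =>
    fixed_horner (digit (A * L) z) (A * L) b r (2 ^ L.+1))).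
  apply: (pr_iteri (pr_mul (pr_const A) (pr_var 0)) pr_zero (g := fun s =>
    digit (A * nth 0 s 2) (nth 0 s 3) (nth 0 s 4 + nth 0 s 0) +
    nth 0 s 1 * nth 0 s 5 %/ 2 ^ (nth 0 s 2).+1)) => //.
  apply: pr_add.
    apply: pr_digit (pr_var 3) (pr_add (pr_var 4) (pr_var 0)).
    exact: pr_mul (pr_const A) (pr_var 2).
  apply: pr_div (pr_mul (pr_var 1) (pr_var 5)) _.
  exact: pr_exp (pr_const 2) (pr_succ (pr_var 2)).
have pM f1 f2 f3 f4 : pr f1 -> pr f2 -> pr f3 -> pr f4 -> pr (fun s =>
    grid_map (digit (A * f1 s) (f2 s)) (f1 s) (f3 s) (f4 s)).
  move=> h1 h2 h3 h4.
  have hN := pr_exp (pr_const 2) h1.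
  have hkm := pr_mul h4 (pr_const m).
  have hb e : pr (fun s => block (A * f1 s) (f3 s) ((f4 s * m) %/ 2 ^ f1 s) e).
    apply: pr_mul (pr_mul (pr_const A) h1); apply: pr_add (pr_const e).
    apply: pr_mul (pr_const 2); apply: pr_add (pr_div hkm hN).
    exact: pr_mul h3 (pr_const _).
  apply: (pr_min hN).
  by apply: pr_sub; apply: (pH _ _ _ _ h1 h2 (hb _) (pr_mod hkm hN)).
have pP f1 f2 f3 : pr f1 -> pr f2 -> pr f3 -> pr (fun s =>
    grid_point (digit (A * f1 s) (f2 s)) (f1 s) (f3 s)).
  apply: (@pr_comp3 (fun L z u => grid_point (digit (A * L) z) L u)).
  apply: (pr_iteri (pr_mul (pr_const A) (pr_var 0)) pr_zero (g := fun s =>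
    grid_map (digit (A * nth 0 s 2) (nth 0 s 3)) (nth 0 s 2)
      (nth 0 s 4 %/ q ^ nth 0 s 0 %% q) (nth 0 s 1))) => //.
  apply: pM (pr_var 2) (pr_var 3) _ (pr_var 1).
  apply: pr_mod (pr_const q); apply: pr_div (pr_var 4) _.
  exact: pr_exp (pr_const q) (pr_var 0).
have pO f1 f2 : pr f1 -> pr f2 -> pr (fun s =>
    grid_output (digit (A * f1 s) (f2 s)) (f1 s)).
  apply: (@pr_comp2 (fun L z => grid_output (digit (A * L) z) L)).
  apply: (pr_iteri (pr_exp (pr_const q) (pr_mul (pr_const A) (pr_var 0)))
    pr_zero (g := fun s => append_frac (nth 0 s 2) (nth 0 s 1)
      (grid_point (digit (A * nth 0 s 2) (nth 0 s 3)) (nth 0 s 2) (nth 0 s 0)))).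
    apply: pr_append_frac (pr_var 2) (pr_var 1) _.
    exact: pP (pr_var 2) (pr_var 3) (pr_var 0).
  by [].
exact: pO (pL _ (pr_succ (pr_var 0))) (pr_succ (pr_var 0)).
Qed.

Lemma grid_outputE a L : grid_output a L =
  wcode (encode [seq frac L (grid_point a L u) | u <- iota 0 (q ^ (A * L))]).
Proof.
rewrite /grid_output; elim: (q ^ _) => [|n IH] //.
rewrite -(addn1 n) iotaD map_cat /encode map_cat flatten_cat addn1 [LHS]/= IH.
by rewrite append_frac_wcode /= cats0 add0n.
Qed.

Lemma levelE L z : 0 < q -> 0 < A ->
  2 ^ (data_factor * L ^ 2) <= z < 2 ^ (data_factor * L ^ 2).+1 -> level z = L.
Proof.
move=> q0 A0 hz.
have G0 : 0 < data_factor by rewrite /data_factor !(expn_gt0, muln_gt0) q0 A0.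
have hL i : (2 ^ (data_factor * i.+1 ^ 2) <= z) = (i < L).
  apply/idP/idP => [h|h].
    have : 2 ^ (data_factor * i.+1 ^ 2) < 2 ^ (data_factor * L ^ 2).+1 by lia.
    by rewrite ltn_exp2l // ltnS leq_pmul2l // leq_exp2r.
  apply: leq_trans (proj1 (andP hz)).
  by rewrite leq_exp2l // leq_pmul2l // leq_exp2r.
have Lz : L <= z.
  have h1 : L < 2 ^ L by exact: ltn_expl.
  have h2 : 2 ^ L <= 2 ^ (data_factor * L ^ 2).
    by rewrite leq_exp2l //; move: G0; rewrite -mulnn; nia.
  by lia.
rewrite /level; suff H n : iteri n (fun i a =>
    a + (2 ^ (data_factor * i.+1 ^ 2) <= z)) 0 = minn n L by rewrite H; lia.
by elim: n => [|n /= ->]; rewrite ?min0n // hL; lia.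
Qed.

(** The machine is chosen before [L] and [a], so its description costs a constant. The decoded
    digits [b] are only claimed to agree with [a] on the positions that are stored. *)
Lemma grid_computes : 0 < q -> 0 < A -> exists M : turing_machine,
  forall (L : nat) (a : nat -> nat), (forall j, a j < 2 ^ (A * L)) ->
  exists p b, [/\ size p = data_factor * L ^ 2,
    forall j, j < 2 * q * m.+1 * (A * L) -> b j = a j
    & computes M p
        (encode [seq frac L (grid_point b L u) | u <- iota 0 (q ^ (A * L))])].
Proof.
move=> q0 A0; have [M hM] := pr_machine pr_decoder.
exists M => L a ha; set K := 2 * q * m.+1 * (A * L).
have [z hz dz] := digits_ex (K := K) (fun j _ => ha j).
have eK : A * L * K = data_factor * L ^ 2.
  by rewrite /K /data_factor; lia.
have hl : 2 ^ (data_factor * L ^ 2) <= 1 * 2 ^ (A * L * K) + z <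
    2 ^ (data_factor * L ^ 2).+1.
  by rewrite -eK mul1n expnS; lia.
have [p sp ep] := wcode_ex hl.
exists p, (digit (A * L) (wcode p).+1); split=> // [j hj|].
  by rewrite ep dz.
apply: hM; rewrite -grid_outputE /decoder /=.
by rewrite (@levelE L) // ep.
Qed.

End Program.

Local Open Scope classical_set_scope.
Local Open Scope ring_scope.

(** * Polynomial charts of analytic maps *)

Section Charts.
Variable R : realType.
Implicit Types (a b : nat -> R) (g : R -> R).

(* The centres of the power series come from compactness and are arbitrary    *)
(* reals; moved to a multiple of [1 / m], the local variable becomes          *)
(* computable from the grid.                                                  *)
Definition recenter a (d : nat) (v : R) (k : nat) : R :=
  \sum_(j < d) a j * (v ^+ (j - k) *+ 'C(j, k)).

Lemma recenter_horner a d v u :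
  \sum_(k < d) recenter a d v k * u ^+ k = \sum_(j < d) a j * (v + u) ^+ j.
Proof.
under eq_bigr => k _ do rewrite /recenter mulr_suml.
rewrite exchange_big /=; apply: eq_bigr => j _.
under eq_bigr => k _ do rewrite -mulrA mulrnAl.
rewrite -mulr_sumr exprDn; congr (_ * _).
rewrite [RHS](big_ord_widen d (fun k => v ^+ (j - k) * u ^+ k *+ 'C(j, k))) //.
rewrite [RHS]big_mkcond; apply: eq_bigr => k _; case: ifP => // hk.
by rewrite bin_small // ltnNge -ltnS hk.
Qed.

(** Up to absolute values, each summand is a single term of the binomial expansion of
    [(|v| + r) ^ j]. The bound obtained at the old centre thus carries over uniformly in [d]. *)
Lemma recenter_norm a d v k (r : R) : 0 <= r ->
  `|recenter a d v k| * r ^+ k <= \sum_(j < d) `|a j| * (`|v| + r) ^+ j.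
Proof.
move=> r0; apply: (@le_trans _ _ (\sum_(j < d)
    `|a j * (v ^+ (j - k) *+ 'C(j, k))| * r ^+ k)).
  by rewrite -mulr_suml ler_wpM2r ?exprn_ge0 // ler_norm_sum.
apply: ler_sum => j _; rewrite normrM -mulrA ler_wpM2l //.
rewrite normrMn normrX mulrnAl.
have [hk|hk] := ltnP j k.
  by rewrite bin_small // mulr0n exprn_ge0 // addr_ge0.
rewrite exprDn (bigD1 (Ordinal (hk : (k < j.+1)%N))) //=.
rewrite lerDl sumr_ge0 // => i _.
by rewrite mulrn_wge0 // mulr_ge0 // exprn_ge0.
Qed.

(** At half the radius the terms are at most [M * 2 ^ -j]; the subtracted last power makes the
    induction close. *)
Lemma geometric_tail a (r M t : R) : 0 < r -> (forall j, `|a j| * r ^+ j <= M) ->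
  `|t| <= r / 2 -> forall d n, (d <= n)%N ->
  \sum_(d <= j < n) `|a j| * `|t| ^+ j <= 2 * M * (2^-1 ^+ d - 2^-1 ^+ n).
Proof.
move=> r0 hM ht d n dn.
rewrite -(subnK dn) addnC; elim: (n - d)%N => [|k IH].
  by rewrite addn0 big_geq // subrr mulr0.
rewrite addnS big_nat_recr /=; last by rewrite leq_addr.
have h : `|a (d + k)%N| * `|t| ^+ (d + k) <= M * 2^-1 ^+ (d + k).
  apply: (@le_trans _ _ (`|a (d + k)%N| * (r / 2) ^+ (d + k))).
    by rewrite ler_wpM2l // lerXn2r ?nnegrE //; lra.
  by rewrite exprMn mulrA ler_wpM2r // exprn_ge0 // invr_ge0.
by rewrite exprS; lra.
Qed.

(** The coefficients may depend on [d], since truncation precedes recentring; only [r] and [M] are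
    uniform. No infinite series has to be rearranged. *)
Definition chartable g (y r M : R) : Prop :=
  forall d : nat, exists b, (forall k, `|b k| * r ^+ k <= M) /\
    forall u, `|u| <= r ->
      `|g (y + u) - \sum_(k < d) b k * u ^+ k| <= M * 2^-1 ^+ d.

Lemma chartableW g y (r r' M M' : R) : 0 <= r' <= r -> M <= M' ->
  chartable g y r M -> chartable g y r' M'.
Proof.
move=> /andP[r0 rr] MM h d; have [b [h1 h2]] := h d; exists b; split=> [k|u hu].
  apply: le_trans MM; apply: le_trans (h1 k).
  by rewrite ler_wpM2l // lerXn2r // nnegrE // (le_trans r0).
apply: le_trans (h2 u (le_trans hu rr)) _.
by rewrite ler_wpM2r // exprn_ge0 // invr_ge0.
Qed.

(** Convergence at [x + r] bounds [a j * r ^ j]. A quarter of [r] for the new centre and a quarter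
    for the local variable stay together within [r / 2], where the tail is geometric. *)
Lemma analytic_chartable g x : analytic_at g x ->
  exists r M : R, 0 < r /\ forall y, `|y - x| <= r -> chartable g y r M.
Proof.
move=> [a /nbhs_ballP[e /= e0 he]].
pose r := e / 2; have r0 : 0 < r by rewrite /r divr_gt0.
have [M hM] : exists M, forall j, `|a j| * r ^+ j <= M.
  have := he (x + r); rewrite -ball_normE /=.
  rewrite opprD addrA subrr sub0r normrN gtr0_norm //.
  move=> /(_ ltac:(rewrite /r; lra)); rewrite addrAC subrr add0r => hc.
  have /cvg_series_cvg_0 h0 : cvgn (pseries a r) by apply/cvg_ex; exists (g (x + r)).
  have : cvgn (fun j => a j * r ^+ j) by apply/cvg_ex; exists 0.
  move=> /cvg_seq_bounded [M [_ /(_ (M + 1) ltac:(lra)) hM]]; exists (M + 1) => j.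
  by have /= := hM j I; rewrite normrM normrX (gtr0_norm r0).
have tail v : `|v| <= r / 2 -> forall d,
    `|g (x + v) - \sum_(j < d) a j * v ^+ j| <= 2 * M * 2^-1 ^+ d.
  move=> hv d.
  have hc : pseries a v @ \oo --> g (x + v).
    have := he (x + v); rewrite -ball_normE /=.
    rewrite opprD addrA subrr sub0r normrN (addrAC x) subrr add0r; apply.
    by apply: le_lt_trans hv _; rewrite /r; lra.
  have M0 : 0 <= M by apply: le_trans (hM 0%N); rewrite mulr_ge0 // exprn_ge0 // ltW.
  have hcd : (fun n => `|pseries a v n - \sum_(j < d) a j * v ^+ j|) @ \oo -->
      `|g (x + v) - \sum_(j < d) a j * v ^+ j|.
    by apply: cvg_norm; apply: cvgB hc _; exact: cvg_cst.
  rewrite -(cvg_lim _ hcd) //; apply: limr_le; first by apply/cvg_ex; eexists; exact: hcd.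
  exists d => // n /= dn.
  rewrite /pseries /series /= -(big_mkord xpredT (fun j => a j * v ^+ j)).
  rewrite (big_cat_nat (leq0n d) dn) /= addrAC subrr add0r.
  apply: le_trans (ler_norm_sum _ _ _) _.
  under eq_bigr => j _ do rewrite normrM normrX.
  apply: le_trans (geometric_tail r0 hM hv dn) _.
  rewrite ler_wpM2l ?mulr_ge0 // gerBl exprn_ge0 // invr_ge0 //.
exists (r / 4), (2 * M); split; first by rewrite divr_gt0.
move=> y hy d; exists (recenter a d (y - x)); split=> [k|u hu].
  apply: le_trans (recenter_norm _ _ _ _ _) _; first by lra.
  have h4 : 0 <= `|y - x| + r / 4 by rewrite addr_ge0 //; lra.
  have := @geometric_tail a r M (`|y - x| + r / 4) r0 hM _ 0%N d (leq0n d).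
  rewrite (ger0_norm h4) expr0 big_mkord => /(_ ltac:(lra)) h; apply: le_trans h _.
  have M0 : 0 <= M by apply: le_trans (hM 0%N); rewrite mulr_ge0 // exprn_ge0 // ltW.
  by rewrite ler_piMr ?mulr_ge0 // gerBl exprn_ge0 // invr_ge0.
rewrite recenter_horner (_ : y + u = x + (y - x + u)); last by lra.
apply: tail; apply: le_trans (ler_normD _ _) _; lra.
Qed.

(** One index serves as inverse radius and as bound. By [chartableW] the property persists when it
    grows, so compactness makes it uniform. *)
Lemma analytic_charts g : (forall x, `[0, 1]%classic x -> analytic_at g x) ->
  \forall n \near \oo, forall y, `[0, 1]%classic y ->
    chartable g y n.+1%:R^-1 n.+1%:R.
Proof.
move=> hg.
have := proj1 (compact_near_coveringP _) (@segment_compact R 0 1).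
move=> /(_ _ \oo (fun n y => chartable g y n.+1%:R^-1 n.+1%:R) _); apply.
move=> x /hg /analytic_chartable [r [M [r0 h]]].
near=> y n => /=.
apply: (chartableW _ _ (h y _)).
- rewrite invr_ge0 ler0n /= -[leRHS]invrK lef_pV2 ?posrE ?invr_gt0 //.
  apply: le_trans (_ : n%:R <= _); last by rewrite ler_nat.
  by near: n; exact: nbhs_infty_ger.
- apply: le_trans (_ : n%:R <= _); last by rewrite ler_nat.
  by near: n; exact: nbhs_infty_ger.
- near: y; apply/nbhs_ballP; exists r => //= y.
  by rewrite -ball_normE /= distrC; exact: ltW.
Unshelve. all: by end_near. Qed.

(** With uniform radius [1 / n.+1], the variable [u] is rescaled to [s = n.+1 * u], which bounds the
    coefficients by [M = n.+1]. The choice [m = 2 * n.+1] makes [s <= 1 / 2] cover a whole cell of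
    length [1 / m]. *)
Lemma ifs_charts (I : finType) (phi : I -> R -> R) :
  (forall i, analytic_on_01 (phi i)) ->
  exists m M : nat, (0 < m)%N /\ forall i (c d : nat), (c <= m)%N ->
    exists b, (forall k, `|b k| <= M%:R) /\
      forall s, 0 <= s <= 1 / 2 -> 0 <= (c%:R + 2 * s) / m%:R <= 1 ->
        `|phi i ((c%:R + 2 * s) / m%:R) - \sum_(k < d) b k * s ^+ k|
          <= M%:R * 2^-1 ^+ d.
Proof.
move=> hphi.
pose P i n := forall y, `[0, 1]%classic y -> forall d, exists b,
  (forall k, `|b k| * n.+1%:R^-1 ^+ k <= n.+1%:R) /\
  forall u, `|u| <= n.+1%:R^-1 -> 0 <= y + u <= 1 ->
    `|phi i (y + u) - \sum_(k < d) b k * u ^+ k| <= n.+1%:R * 2^-1 ^+ d.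
have [n _ /(_ n (leqnn n)) hn] : \forall n \near \oo, forall i, P i n.
  apply: filter_forall => i; have [V [g [_ hV hg eg]]] := hphi i.
  have := analytic_charts (fun x hx => hg x (hV x hx)).
  apply: filterS => n hn y hy d; have [b [h1 h2]] := hn y hy d.
  by exists b; split=> // u hu hyu; rewrite eg ?h2 // in_itv.
exists (2 * n.+1)%N, n.+1; split=> // i c d hc.
have n0 : 0 < n.+1%:R :> R by [].
have hy : `[0, 1]%classic (c%:R / (2 * n.+1)%:R : R).
  rewrite /= in_itv /= divr_ge0 // ler_pdivrMr ?mul1r ?ler_nat //.
have [b [h1 h2]] := hn i _ hy d.
exists (fun k => b k * n.+1%:R^-1 ^+ k); split=> [k|s hs hx].
  rewrite normrM [X in _ * X]ger0_norm ?h1 // exprn_ge0 // invr_ge0 //.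
have e : (c%:R + 2 * s) / (2 * n.+1)%:R = c%:R / (2 * n.+1)%:R + s / n.+1%:R.
  by rewrite natrM; field; rewrite addrC natr1 pnatr_eq0.
under eq_bigr => k _ do rewrite -mulrA -exprMn (mulrC _ s).
rewrite e; apply: h2; last by rewrite -e.
rewrite normrM ger0_norm ?(ger0_norm (_ : 0 <= n.+1%:R^-1)) ?invr_ge0 //; last lra.
by rewrite ler_piMl ?invr_ge0 //; lra.
Qed.

End Charts.

(** * Error estimates *)

Section Approximation.
Variable R : realType.

Lemma divn_err (y r D : nat) : (0 < D)%N ->
  `|(y * r %/ D)%:R - y%:R * (r%:R / D%:R)| <= 1 :> R.
Proof.
move=> D0; have D0R : 0 < D%:R :> R by rewrite ltr0n.
rewrite mulrA -natrM; set z := (y * r)%N.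
have h1 : (z %/ D)%:R <= z%:R / D%:R :> R.
  by rewrite ler_pdivlMr // -natrM ler_nat leq_divM.
have h2 : z%:R / D%:R <= (z %/ D)%:R + 1 :> R.
  by rewrite ler_pdivrMr // natr1 -natrM ler_nat ltnW // ltn_ceil.
rewrite ler_norml; lra.
Qed.

(** The bound 4 is the fixed point of [e -> 1 + 1 + e / 2]: one unit for the coefficient, one for
    the division, and half of the previous error. *)
Lemma fixed_horner_err (a : nat -> nat) (b : nat -> R) (N : R) base (r D n : nat) :
  (0 < D)%N -> (r * 2 <= D)%N ->
  (forall t, (t < n)%N -> `|(a (base + t)%N)%:R - N * b t| <= 1) ->
  `|(fixed_horner a n base r D)%:R
     - N * \sum_(t < n) b t * (r%:R / D%:R) ^+ (n.-1 - t)| <= 4.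
Proof.
move=> D0 hr; set s : R := r%:R / D%:R.
have hs : 0 <= s <= 1 / 2.
  have D0R : 0 < D%:R :> R by rewrite ltr0n.
  rewrite divr_ge0 //= ler_pdivrMr //.
  by have : (r * 2)%:R <= D%:R :> R; [rewrite ler_nat | rewrite natrM; lra].
elim: n => [|n IH] hb; first by rewrite /fixed_horner /= big_ord0 mulr0 subrr normr0.
have {}IH := IH (fun t h => hb t (ltnW h)).
have -> : \sum_(t < n.+1) b t * s ^+ (n.+1.-1 - t) =
    (\sum_(t < n) b t * s ^+ (n.-1 - t)) * s + b n.
  rewrite big_ord_recr /= subnn expr0 mulr1 mulr_suml; congr (_ + _).
  apply: eq_bigr => t _; rewrite -mulrA -exprSr; congr (_ * _ ^+ _).
  by have := ltn_ord t; lia.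
set h := \sum_(t < n) _ in IH *.
rewrite /fixed_horner /= -/(fixed_horner a n base r D) natrD.
set y := fixed_horner _ _ _ _ _ in IH *.
have h1 := hb n (leqnn _); have h2 := divn_err y r D0; rewrite -/s in h2.
have -> : (a (base + n)%N)%:R + (y * r %/ D)%:R - N * (h * s + b n) =
  ((a (base + n)%N)%:R - N * b n) + ((y * r %/ D)%:R - y%:R * s)
  + (y%:R - N * h) * s by ring.
apply: le_trans (ler_normD _ _) _; rewrite normrM (ger0_norm (_ : 0 <= s)); last lra.
have h3 : `|y%:R - N * h| * s <= 4 * (1 / 2) by apply: ler_pM => //; lra.
have := ler_normD ((a (base + n)%N)%:R - N * b n) ((y * r %/ D)%:R - y%:R * s).
lra.
Qed.

(** Truncated subtraction and [minn] project onto the interval from 0 to [N], which contains [v], so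
    they bring the value no farther from [v]. *)
Lemma minn_sub_err (x y N : nat) (v e : R) : 0 <= v <= N%:R ->
  `|x%:R - y%:R - v| <= e -> `|(minn N (x - y))%:R - v| <= e.
Proof.
move=> hv; rewrite !ler_norml => he.
have [hxy|hxy] := leqP x y.
  have -> : minn N (x - y) = 0%N by lia.
  by have : x%:R <= y%:R :> R; [rewrite ler_nat | lra].
have hd : (x - y)%:R = x%:R - y%:R :> R by rewrite natrB // ltnW.
rewrite /minn; case: ltnP => h; last by rewrite hd; lra.
have : N%:R <= (x - y)%:R :> R by rewrite ler_nat ltnW.
by rewrite hd; lra.
Qed.

Lemma truncn_err (x : R) : 0 <= x -> `|(Num.truncn x)%:R - x| <= 1.
Proof.
by move=> /truncn_itv; rewrite -natr1 ler_norml => h; lra.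
Qed.

Variables (I : finType) (phi : I -> R -> R) (i0 : I) (m M : nat).
Hypothesis m_gt0 : (0 < m)%N.
Hypothesis phi01 : forall i x, 0 <= x <= 1 -> 0 <= phi i x <= 1.

Definition map_index (u : nat) : I := nth i0 (enum I) u.

(* Leading coefficients come first, as Horner's rule consumes them.           *)
Definition coef_digit (b : I -> nat -> nat -> R) (n : nat) (N : R) (j : nat) : nat :=
  let k := (j %/ n)%N in
  let x := b (map_index (k %/ 2 %/ m.+1)) (k %/ 2 %% m.+1)%N
             (n.-1 - j %% n)%N in
  Num.truncn (N * Num.max (if (k %% 2 == 0)%N then x else - x) 0).

Lemma coef_digit_block b n N i c e t : (c <= m)%N -> (t < n)%N -> (e < 2)%N ->
  coef_digit b n N (block m n i c e + t) =
  Num.truncn (N * Num.max (if e == 0%N then b (map_index i) c (n.-1 - t)%N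
                           else - b (map_index i) c (n.-1 - t)%N) 0).
Proof.
move=> hc ht he; rewrite /coef_digit /block.
have n0 : (0 < n)%N by lia.
have hdiv u v D : (v < D)%N -> ((u * D + v) %/ D)%N = u.
  by move=> h; rewrite divnMDl ?(divn_small h) ?addn0 //; lia.
have hmod u v D : (v < D)%N -> ((u * D + v) %% D)%N = v.
  by move=> h; rewrite modnMDl modn_small.
by rewrite (hdiv _ _ _ ht) (hmod _ _ _ ht) (hdiv _ _ _ he) (hmod _ _ _ he) hdiv ?hmod.
Qed.

(** Each of the two Horner evaluations, for the positive and the negative parts, costs 4. The
    polynomial approximation costs [2 ^ L * M * 2 ^ -(A * L)], at most [M]. *)
Lemma grid_map_err (A L : nat) (b : I -> nat -> nat -> R) (a : nat -> nat) i k :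
  let n := (A * L)%N in
  (0 < A)%N ->
  (forall c, (c <= m)%N -> forall s, 0 <= s <= 1 / 2 ->
     0 <= (c%:R + 2 * s) / m%:R <= 1 ->
     `|phi (map_index i) ((c%:R + 2 * s) / m%:R)
        - \sum_(t < n) b (map_index i) c t * s ^+ t| <= M%:R * 2^-1 ^+ n) ->
  (forall c e t, (c <= m)%N -> (e < 2)%N -> (t < n)%N ->
     a (block m n i c e + t)%N = coef_digit b n (2 ^+ L) (block m n i c e + t)) ->
  (k <= 2 ^ L)%N ->
  `|(grid_map m A a L i k)%:R - 2 ^+ L * phi (map_index i) (k%:R / 2 ^+ L)|
     <= 8 + M%:R.
Proof.
move=> n A0 hb ha hk; rewrite /grid_map -/n.
set N : R := 2 ^+ L; have N0 : 0 < N by rewrite exprn_gt0.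
have eN : (2 ^ L)%:R = N by rewrite natrX.
have m0 : 0 < m%:R :> R by rewrite ltr0n.
set c := (k * m %/ 2 ^ L)%N; set r := (k * m %% 2 ^ L)%N.
have hc : (c <= m)%N.
  apply: (@leq_trans ((2 ^ L * m) %/ 2 ^ L)); last by rewrite mulKn ?expn_gt0.
  by rewrite leq_div2r // leq_mul2r hk orbT.
have hr : (r < 2 ^ L)%N by rewrite ltn_mod expn_gt0.
have hx : 0 <= k%:R / N <= 1.
  by rewrite divr_ge0 ?(ltW N0) //= ler_pdivrMr // mul1r -eN ler_nat.
set s : R := r%:R / (2 ^ L.+1)%:R.
have es : s = r%:R / (2 * N) by rewrite /s natrX exprS.
have hs : 0 <= s <= 1 / 2.
  rewrite es divr_ge0 ?mulr_ge0 ?(ltW N0) //= ler_pdivrMr ?mulr_gt0 //.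
  by have : r%:R <= N; [rewrite -eN ler_nat ltnW | lra].
have ex : (c%:R + 2 * s) / m%:R = k%:R / N.
  have : (k * m)%:R = c%:R * N + r%:R.
    by rewrite {1}(divn_eq (k * m) (2 ^ L)) natrD natrM eN.
  rewrite natrM es => h; have N0' : N != 0 by rewrite gt_eqF.
  have m0' : m%:R != 0 :> R by rewrite gt_eqF.
  apply: (mulfI m0'); apply: (mulfI N0').
  transitivity (c%:R * N + r%:R); last by rewrite -h; field; rewrite N0'.
  by field; rewrite N0' m0'.
have hphi := hb c hc s hs; rewrite ex in hphi; have {}hphi := hphi hx.
apply: minn_sub_err.
  have := phi01 (map_index i) hx; rewrite eN => /andP[p1 p2].
  by rewrite mulr_ge0 ?(ltW N0) //= ler_piMr // ltW.
pose B e t : R := Num.max (if e == 0%N then b (map_index i) c (n.-1 - t)%N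
                           else - b (map_index i) c (n.-1 - t)%N) 0.
have hH e : (e < 2)%N ->
    `|(fixed_horner a n (block m n i c e) r (2 ^ L.+1))%:R
       - N * \sum_(t < n) B e t * s ^+ (n.-1 - t)| <= 4.
  move=> he; apply: fixed_horner_err; rewrite ?expn_gt0 //.
    by rewrite expnS mulnC leq_mul2l ltnW.
  move=> t ht; rewrite ha // coef_digit_block //.
  by apply: truncn_err; rewrite mulr_ge0 ?(ltW N0) // le_max lexx orbT.
have h0 := hH 0%N isT; have h1 := hH 1%N isT.
have eS : \sum_(t < n) b (map_index i) c t * s ^+ t =
    \sum_(t < n) B 0%N t * s ^+ (n.-1 - t) - \sum_(t < n) B 1%N t * s ^+ (n.-1 - t).
  rewrite -sumrB (reindex_inj rev_ord_inj) /=; apply: eq_bigr => t _.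
  rewrite -mulrBl (_ : (n - t.+1)%N = (n.-1 - t)%N); last by rewrite -subn1 -subnDA.
  congr (_ * _); rewrite /B /=; set z := b _ _ _.
  rewrite /Order.max; case: (ltP z 0) => ?; case: (ltP (- z) 0) => ?; lra.
set S0 := \sum_(t < n) B 0%N t * _ in h0 eS.
set S1 := \sum_(t < n) B 1%N t * _ in h1 eS.
rewrite eS in hphi.
have hd : N * (M%:R * 2^-1 ^+ n) <= M%:R.
  rewrite mulrCA ler_piMr // exprVn ler_pdivrMr ?exprn_gt0 // mul1r.
  by rewrite ler_weXn2l ?ler1n // leq_pmull.
have hphi' : `|N * (S0 - S1) - N * phi (map_index i) (k%:R / N)| <= M%:R.
  rewrite -mulrBr normrM (gtr0_norm N0) distrC; apply: le_trans hd.
  by rewrite ler_wpM2l ?(ltW N0).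
move: h0 h1 hphi'; rewrite mulrBr !ler_norml; lra.
Qed.

End Approximation.

(** * Discretised orbits and the Hausdorff distance *)

Section Orbits.
Variables (R : realType) (I : finType) (phi : I -> R -> R) (i0 : I) (K : set R).
Variables (rho : R).
Hypothesis rho01 : 0 < rho < 1.
Hypothesis phi01 : forall i x, 0 <= x <= 1 -> 0 <= phi i x <= 1.
Hypothesis phi_contract : forall i x y, 0 <= x <= 1 -> 0 <= y <= 1 ->
  `|phi i x - phi i y| <= rho * `|x - y|.
Hypothesis K01 : forall x, K x -> 0 <= x <= 1.
Hypothesis K_self_similar : K = \bigcup_(i in [set: I]) (phi i @` K).

(* The digits of [u] in base [#|I|] are the indices of the composed maps.     *)
Definition orbit_point (n u : nat) (x : R) : R :=
  iteri n (fun t x => phi (map_index i0 (u %/ #|I| ^ t %% #|I|)%N) x) x.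

Lemma orbit_point_in n u x : K x -> K (orbit_point n u x).
Proof.
move=> Kx; rewrite /orbit_point; elim: n => [|n IH] //=.
set y := iteri n _ x in IH *; rewrite K_self_similar.
by exists (map_index i0 (u %/ #|I| ^ n %% #|I|)%N) => //; exists y.
Qed.

(** Self-similarity is unfolded [n] times. The outermost map is applied last, so its index becomes
    the leading digit of [u] and leaves the lower digits unchanged. *)
Lemma orbit_point_onto n y : K y ->
  exists u x, [/\ (u < #|I| ^ n)%N, K x & orbit_point n u x = y].
Proof.
elim: n y => [|n IH] y Ky; first by exists 0%N, y.
move: (Ky); rewrite {1}K_self_similar => -[i _ [y' Ky' <-]].
have [u [x [hu Kx ex]]] := IH y' Ky'.
have q0 : (0 < #|I|)%N by apply/card_gt0P; exists i0.
exists (enum_rank i * #|I| ^ n + u)%N, x; split=> //.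
  apply: (@leq_trans ((enum_rank i).+1 * #|I| ^ n)); first by rewrite mulSn; lia.
  by rewrite expnS leq_mul2r ltn_ord orbT.
rewrite /orbit_point /= divnMDl ?expn_gt0 ?q0 // (divn_small hu) addn0.
rewrite modn_small // {1}/map_index nth_enum_rank; congr phi.
rewrite -ex /orbit_point; move: (leqnn n).
suff H k : (k <= n)%N -> iteri k (fun t x => phi (map_index i0
    ((enum_rank i * #|I| ^ n + u) %/ #|I| ^ t %% #|I|)%N) x) x =
    iteri k (fun t x => phi (map_index i0 (u %/ #|I| ^ t %% #|I|)%N) x) x.
  exact: H.
elim: k => //= k IHk hk; rewrite IHk ?(ltnW hk) //; congr (phi (map_index _ _) _).
have -> : (#|I| ^ n = #|I| ^ (n - k.+1) * #|I| * #|I| ^ k)%N.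
  by rewrite -expnSr -expnD; congr expn; lia.
by rewrite mulnA divnMDl ?expn_gt0 ?q0 // mulnA modnMDl.
Qed.

(** [E / (1 - rho)] is the fixed point of [e -> rho * e + E], in grid steps; the power of [rho] is
    what remains of the distance, at most 1, between the starting points 0 and [x]. *)
Lemma grid_point_err (m A L : nat) (a : nat -> nat) (E : R) u x :
  0 <= E ->
  (forall i k, (i < #|I|)%N -> (k <= 2 ^ L)%N -> `|(grid_map m A a L i k)%:R
     - 2 ^+ L * phi (map_index i0 i) (k%:R / 2 ^+ L)| <= E) ->
  0 <= x <= 1 ->
  (grid_point #|I| m A a L u <= 2 ^ L)%N /\
  `|(grid_point #|I| m A a L u)%:R / 2 ^+ L - orbit_point (A * L) u x|
    <= rho ^+ (A * L) + E / (1 - rho) / 2 ^+ L.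
Proof.
move=> E0 hT hx; set N : R := 2 ^+ L; have N0 : 0 < N by rewrite exprn_gt0.
have q0 : (0 < #|I|)%N by apply/card_gt0P; exists i0.
have [r0 r1] := andP rho01.
rewrite /grid_point /orbit_point; elim: (A * L)%N => [|n [IH1 IH2]] /=.
  split=> //; rewrite mul0r sub0r normrN expr0.
  have : 0 <= E / (1 - rho) / N by rewrite !divr_ge0 ?(ltW N0) //; lra.
  by rewrite ger0_norm; lra.
set k := iteri n _ 0%N in IH1 IH2 *; set y := iteri n _ x in IH2 *.
set i := (_ %% _)%N; have hi : (i < #|I|)%N by rewrite ltn_mod.
split; first by rewrite /grid_map geq_minl.
have hk : 0 <= k%:R / N <= 1.
  rewrite divr_ge0 ?(ltW N0) //= ler_pdivrMr // mul1r.
  by rewrite /N -natrX ler_nat.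
have hy : 0 <= y <= 1.
  by rewrite /y; elim: n {IH1 IH2 k y i hi hk} => //= n IH; exact: phi01.
have h1 := hT i k hi IH1; have h2 := phi_contract (map_index i0 i) hk hy.
have h3 : `|(grid_map m A a L i k)%:R / N - phi (map_index i0 i) (k%:R / N)| <= E / N.
  rewrite ler_pdivlMr // -[X in _ * X](gtr0_norm N0) -normrM mulrBl.
  by rewrite divfK ?gt_eqF // [phi _ _ * N]mulrC.
have h4 : rho * `|k%:R / N - y| <= rho * (rho ^+ n + E / (1 - rho) / N).
  by rewrite ler_wpM2l // ltW.
have e : E / N = E / (1 - rho) / N - rho * (E / (1 - rho) / N).
  by field; rewrite gt_eqF //= gt_eqF //; lra.
have h5 := ler_normD ((grid_map m A a L i k)%:R / N - phi (map_index i0 i) (k%:R / N))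
  (phi (map_index i0 i) (k%:R / N) - phi (map_index i0 i) y).
rewrite addrA subrK in h5.
by rewrite exprS; lra.
Qed.

Lemma hausdorff_dist_le (F1 F2 : set R) (e : R) :
  (forall x, F1 x -> exists2 y, F2 y & `|x - y| <= e) ->
  (forall y, F2 y -> exists2 x, F1 x & `|y - x| <= e) ->
  (hausdorff_dist F1 F2 <= e%:E)%E.
Proof.
move=> h1 h2; rewrite /hausdorff_dist ge_max; apply/andP; split.
  apply: ub_ereal_sup => _ [y /h2[x Fx hx] <-].
  apply: (@le_trans _ _ (`|y - x|)%:E); last by rewrite lee_fin.
  by apply: ereal_inf_lbound; exists x.
apply: ub_ereal_sup => _ [x /h1[y Fy hy] <-].
apply: (@le_trans _ _ (`|x - y|)%:E); last by rewrite lee_fin.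
by apply: ereal_inf_lbound; exists y.
Qed.

(** The address [u] pairs grid points with points of [K]: a fixed [y0] in [K] serves every grid
    point, while a given [y] in [K] dictates both the address and the starting point. *)
Lemma grid_hausdorff (m A L : nat) (a : nat -> nat) (E : R) (K0 : K !=set0) :
  0 <= E ->
  (forall i k, (i < #|I|)%N -> (k <= 2 ^ L)%N -> `|(grid_map m A a L i k)%:R
     - 2 ^+ L * phi (map_index i0 i) (k%:R / 2 ^+ L)| <= E) ->
  (hausdorff_dist [set` [seq fraction_val R x | x <-
     [seq frac L (grid_point #|I| m A a L u) | u <- iota 0 (#|I| ^ (A * L))]]] K
   <= (rho ^+ (A * L) + E / (1 - rho) / 2 ^+ L)%:E)%E.
Proof.
move=> E0 hT; have [y0 Ky0] := K0.
have hp u x := @grid_point_err m A L a E u x E0 hT.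
have hv u : fraction_val R (frac L (grid_point #|I| m A a L u)) =
    (grid_point #|I| m A a L u)%:R / 2 ^+ L.
  by rewrite fraction_val_frac //; have [] := hp u y0 (K01 Ky0).
apply: hausdorff_dist_le => [x|y Ky] /=.
  move=> /mapP[_ /mapP[u hu ->] ->]; exists (orbit_point (A * L) u y0).
    exact: orbit_point_in.
  by rewrite hv; have [] := hp u y0 (K01 Ky0).
have [u [x [hu Kx <-]]] := orbit_point_onto (A * L) Ky.
exists (fraction_val R (frac L (grid_point #|I| m A a L u))).
  by apply: map_f; apply: map_f; rewrite mem_iota.
by rewrite hv distrC; have [] := hp u x (K01 Kx).
Qed.

End Orbits.

(** * Size of the data and choice of the scale *)

(** The digit is at most [2 ^ L * M], and [M < 2 ^ M <= 2 ^ (A.-1 * L)] because [M < A]. *)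
Lemma coef_digit_lt (R : realType) (I : finType) (i0 : I) (m M A L : nat)
    (b : I -> nat -> nat -> R) j :
  (0 < L)%N -> (M < A)%N ->
  (forall i c k, (c <= m)%N -> `|b i c k| <= M%:R) ->
  (coef_digit i0 m b (A * L) (2 ^+ L) j < 2 ^ (A * L))%N.
Proof.
move=> L0 MA hb; rewrite /coef_digit; set x := b _ _ _.
have hx : `|x| <= M%:R by apply: hb; rewrite -ltnS ltn_mod.
set y := Num.max _ _; have hy : 0 <= y <= M%:R.
  rewrite /y le_max lexx orbT /= ge_max ler0n andbT.
  by move: hx; rewrite ler_norml; case: ifP => _; lra.
have N0 : 0 < 2 ^+ L :> R by rewrite exprn_gt0.
rewrite truncn_lt_nat; last by rewrite mulr_ge0 ?(ltW N0) //; lra.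
have -> : (A * L = L + A.-1 * L)%N by nia.
rewrite natrX exprD ltr_pM2l //; apply: (@le_lt_trans _ _ M%:R); first by lra.
rewrite -natrX ltr_nat; apply: leq_trans (ltn_expl M (ltnSn 1)) _.
rewrite leq_exp2l //; nia.
Qed.

(** [L] is about [log2 (1 / eps)] plus a constant [B] with [c < 2 ^ B]. The bound [eps <= 1 / e]
    gives [ln (1 / eps) >= 1], which absorbs additive constants into [C]. *)
Lemma level_ex (R : realType) (c : R) : exists2 C : R, 0 < C &
  forall eps : R, 0 < eps <= expR (-1) -> exists L : nat,
    [/\ (0 < L)%N, c / 2 ^+ L < eps & L%:R <= C * ln eps^-1].
Proof.
have ln2 : 0 < ln 2 :> R by rewrite ln_gt0 // ltr1n.
pose B := (Num.truncn c).+1.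
have hB : c < 2 ^+ B.
  apply: (lt_trans (truncnS_gt c)); rewrite -natrX ltr_nat.
  exact: ltn_expl.
exists ((ln 2)^-1 + 1 + B%:R); first by rewrite !addr_gt0 ?invr_gt0.
move=> eps /andP[e0 e1]; set T := ln eps^-1.
have hT : 1 <= T.
  by rewrite /T lnV ?posrE // lerNr -[leRHS]expRK ler_ln ?posrE ?expR_gt0.
have expT : expR T = eps^-1 by rewrite lnK // posrE invr_gt0.
pose L0 := (Num.truncn (T / ln 2)).+1; exists (L0 + B)%N; split=> //.
- have h0 : eps^-1 < 2 ^+ L0.
    have -> : 2 ^+ L0 = expR (ln 2 * L0%:R) :> R.
      by rewrite expRM_natr lnK // posrE.
    rewrite -expT ltr_expR mulrC -ltr_pdivrMr //; exact: truncnS_gt.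
  rewrite exprD ltr_pdivrMr ?mulr_gt0 ?exprn_gt0 //.
  apply: (lt_trans hB); rewrite mulrA -[ltLHS]mul1r ltr_pM2r ?exprn_gt0 //.
  by rewrite mulrC -ltr_pdivrMr // mul1r.
- have h1 : (Num.truncn (T / ln 2))%:R <= T / ln 2.
    by rewrite truncn_le divr_ge0 ?(ltW ln2) //; lra.
  have h0 : L0%:R = (Num.truncn (T / ln 2))%:R + 1 :> R by rewrite natr1.
  rewrite natrD h0 !mulrDl mul1r [_^-1 * T]mulrC.
  have h2 : B%:R <= B%:R * T by rewrite ler_peMr ?ler0n.
  by lra.
Qed.

Unset Implicit Arguments.

Theorem theorem2p2 (R : realType) (U : turing_machine) (I : finType)
    (phi : I -> R -> R) (K : set R) :
  universal U ->
  is_ifs phi ->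
  is_cantor_set phi K ->
  (forall i : I, analytic_on_01 (phi i)) ->
  exists2 C : R, 0 < C &
    \forall eps \near 0^'+,
      (distortion_complexity U K eps <= (C * ln (eps^-1) ^+ 2)%:E)%E.
Proof.
move=> univU [I2 phi_sub _ [rho rho01 phi_contr] _] [K0 _ K01 K_eq] phi_an.
have [r0 r1] := andP rho01.
have q0 : (0 < #|I|)%N by exact: ltnW.
have [i0 _] := card_gt0P q0.
have phi01 i x : 0 <= x <= 1 -> 0 <= phi i x <= 1.
  move=> hx; have := phi_sub i (phi i x); rewrite /= in_itv /=; apply.
  by exists x => //=; rewrite in_itv.
have contr i x y : 0 <= x <= 1 -> 0 <= y <= 1 ->
    `|phi i x - phi i y| <= rho * `|x - y|.
  by move=> hx hy; apply: phi_contr; rewrite in_itv.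
have K01' x : K x -> 0 <= x <= 1 by move=> /K01; rewrite /= in_itv.
have [m [M [m0 charts]]] := ifs_charts phi_an.
have [A0 hA0] : exists A0, rho ^+ A0 <= 2^-1.
  have := @cvg_expr R rho; rewrite ger0_norm ?(ltW r0) // => /(_ r1).
  move=> /cvgrPdist_le /(_ 2^-1 ltac:(by rewrite invr_gt0)) [n _ hn].
  exists n; have := hn n (leqnn n).
  by rewrite /= sub0r normrN ger0_norm // exprn_ge0 // ltW.
(* [A0] makes [A * L] composed maps contract by [2 ^ -L]; [M.+1] makes a coefficient fit in [A * L]
   bits. *)
pose A := (A0 + M.+1)%N.
have hA : rho ^+ A <= 2^-1.
  apply: le_trans hA0; apply: ler_wiXn2l; rewrite ?(ltW r0) ?(ltW r1) //.
  exact: leq_addr.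
have A_gt0 : (0 < A)%N by rewrite /A addnS.
have MA : (M < A)%N by rewrite /A addnS ltnS leq_addl.
have [T hT] := grid_computes m q0 A_gt0.
have [desc hdesc] := univU T.
pose E : R := 8 + M%:R; have E0 : 0 <= E by rewrite addr_ge0.
have [C1 C1_gt0 hC1] := @level_ex R (1 + E / (1 - rho)).
pose G : R := (data_factor #|I| m A)%:R.
have G0 : 0 <= G by rewrite ler0n.
exists ((size desc)%:R + G * C1 ^+ 2 + 1).
  by rewrite ltr_wpDl // addr_ge0 // mulr_ge0 // exprn_ge0 // ltW.
near=> eps.
have eps0 : 0 < eps by near: eps; exact: nbhs_right_gt.
have eps1 : eps <= expR (-1) by near: eps; apply: nbhs_right_le; exact: expR_gt0.
have [L [L0 hL LC]] := hC1 eps ltac:(by rewrite eps0 eps1).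
set t := ln eps^-1 in LC *.
have ht : 1 <= t.
  by rewrite /t lnV ?posrE // lerNr -[leRHS]expRK ler_ln ?posrE ?expR_gt0.
pose n := (A * L)%N.
(* The polynomials depend on [n], hence on [eps], and are chosen only now. The guard on the chart
   number makes the choice total. *)
pose good (x : I * nat) (f : nat -> R) := (x.2 <= m)%N ->
    (forall k, `|f k| <= M%:R) /\
      forall s, 0 <= s <= 1 / 2 -> 0 <= (x.2%:R + 2 * s) / m%:R <= 1 ->
        `|phi x.1 ((x.2%:R + 2 * s) / m%:R) - \sum_(k < n) f k * s ^+ k|
          <= M%:R * 2^-1 ^+ n.
have [b hb] : {b & forall x, good x (b x)}.
  apply: choice => -[i c]; rewrite /good /=.
  have [hc|hc] := leqP c m; last by exists (fun=> 0).
  by have [f hf] := charts i c n hc; exists f => _.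
pose B i c k := b (i, c) k.
pose a j := coef_digit i0 m B n (2 ^+ L) j.
have ha j : (a j < 2 ^ (A * L))%N.
  apply: (@coef_digit_lt _ _ _ _ M) => // i c k hc.
  by have [h _] := hb (i, c) hc; exact: h.
have [p [d [sp hd comp]]] := hT L a ha.
have hmap i k : (i < #|I|)%N -> (k <= 2 ^ L)%N -> `|(grid_map m A d L i k)%:R
     - 2 ^+ L * phi (map_index i0 i) (k%:R / 2 ^+ L)| <= E.
  move=> hi hk; apply: (@grid_map_err _ _ _ i0 m M m0 phi01 A L B) => //.
    by move=> c hc s; have [_ h] := hb (map_index i0 i, c) hc; exact: h.
  by move=> c e j hc he hj; rewrite hd // block_lt.
have hdist := grid_hausdorff rho01 phi01 contr K01' K_eq K0 E0 hmap.
apply: (@le_trans _ _ ((size (desc ++ p))%:R)%:E).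
  apply: ereal_inf_lbound; exists (desc ++ p) => //.
  eexists.
    exists [seq frac L (grid_point #|I| m A d L u) | u <- iota 0 (#|I| ^ (A * L))].
    split; [|exact/hdesc|reflexivity].
    by apply/allP => _ /mapP[u _ ->]; exact: wf_frac.
  apply: le_lt_trans hdist _; rewrite lte_fin; apply: le_lt_trans hL.
  rewrite [leRHS]mulrDl [in leRHS]mul1r lerD2r exprM -exprVn.
  by apply: lerXn2r; rewrite ?nnegrE ?exprn_ge0 ?invr_ge0 // ltW.
rewrite lee_fin size_cat sp natrD natrM natrX -/G.
have h1 : (size desc)%:R <= (size desc)%:R * t ^+ 2 by rewrite ler_peMr // exprn_ege1.
have h2 : G * L%:R ^+ 2 <= G * (C1 ^+ 2 * t ^+ 2).
  rewrite ler_wpM2l // -exprMn lerXn2r ?nnegrE ?ler0n //.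
  by rewrite mulr_ge0 ?(ltW C1_gt0) //; lra.
have h3 : 0 <= t ^+ 2 by rewrite exprn_ge0 //; lra.
by rewrite !mulrDl -mulrA; lra.
Unshelve. all: by end_near. Qed.
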